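(* Let $r\geq 1$ be an integer, let $a,\mu$ be real parameters, and let $\mathbf{n}=(n_1,\dots,n_r)\in\mathbb{N}_0^r$. For $\boldsymbol{\xi}=(\xi_1,\dots,\xi_r)\in\mathbb{R}^r$, the Fourier transform of $f_r(\mathbf{x};\mathbf{n},a,\mu)$ satisfies \begin{multline*} \mathcal{F}\big(f_r(x_1,\dots,x_r;n_1,\dots,n_r,a,\mu)\big)(\xi_1,\dots,\xi_r) =\frac{2^{|\mathbf{n}^2|+2a+\frac{r-3}{2}}\left(2\left(|\mathbf{n}^2|+\mu+\frac{r-1}{2}\right)\right)_{n_1}}{n_1!}\\ \times B\left(a+\frac{|\mathbf{n}^2|+i\xi_1}{2}+\frac{r-1}{4},\ a+\frac{|\mathbf{n}^2|-i\xi_1}{2}+\frac{r-1}{4}\right)\\ \times {}_3F_2\left(\begin{matrix}-n_1,\ n_1+2\left(|\mathbf{n}^2|+\mu+\frac{r-1}{2}\right),\ a+\frac{|\mathbf{n}^2|+i\xi_1}{2}+\frac{r-1}{4}\\ |\mathbf{n}^2|+2a+\frac{r-1}{2},\ |\mathbf{n}^2|+\mu+\frac{r}{2}\end{matrix}\;\Big|\;1\right)\\ \times \mathcal{F}\big(f_{r-1}(x_2,\dots,x_r;n_2,\dots,n_r,a,\mu)\big)(\xi_2,\dots,\xi_r), \end{multline*} and also \begin{multline*} \mathcal{F}\big(f_r(x_1,\dots,x_r;n_1,\dots,n_r,a,\mu)\big)(\xi_1,\dots,\xi_r) =\frac{2^{2a-1}(2\mu)_{n_r}}{n_r!}B\left(a+\frac{i\xi_r}{2},\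 a-\frac{i\xi_r}{2}\right)\\ \times {}_3F_2\left(\begin{matrix}-n_r,\ n_r+2\mu,\ a+\frac{i\xi_r}{2}\\ 2a,\ \mu+\frac12\end{matrix}\;\Big|\;1\right)\\ \times \mathcal{F}\Big(f_{r-1}\Big(x_1,\dots,x_{r-1};n_1,\dots,n_{r-1},a+\frac{n_r}{2}+\frac14,\mu+n_r+\frac12\Big)\Big)(\xi_1,\dots,\xi_{r-1}). \end{multline*}
   Context: Pochhammer symbol: $(\alpha)_0=1$, $(\alpha)_n=\alpha(\alpha+1)\cdots(\alpha+n-1)$ for $n\ge1$. Generalized hypergeometric series: ${}_pF_q\left(\begin{matrix}a_1,\dots,a_p\\ b_1,\dots,b_q\end{matrix}\mid x\right)=\sum_{k\ge0}\frac{(a_1)_k\cdots(a_p)_k}{(b_1)_k\cdots(b_q)_k}\frac{x^k}{k!}$ (here always terminating because of a numerator $-n$). Beta function $B(p,q)=\Gamma(p)\Gamma(q)/\Gamma(p+q)$. Gegenbauer polynomials: $C_n^{(\lambda)}(x)=\frac{(2\lambda)_n}{n!}\,{}_2F_1\left(\begin{matrix}-n,\ n+2\lambda\\ \lambda+\frac12\end{matrix}\mid\frac{1-x}{2}\right)$. Notation: for $\mathbf{n}=(n_1,\dots,n_s)$, $\mathbf{n}^j=(n_j,\dots,n_s)$, $|\mathbf{n}^j|=n_j+\cdots+n_s$ for $1\le j\le s$, and $|\mathbf{n}^{s+1}|=0$. For $\boldsymbol{y}=(y_1,\dots,y_s)$, $\boldsymbol{y}_0=0$, $\boldsymbol{y}_j=(y_1,\dots,y_j)$,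 $\|\cdot\|$ the Euclidean norm. Ball polynomials in $s$ variables: $P^{\mu}_{\mathbf{n}}(\boldsymbol{y})=\prod_{j=1}^{s}(1-\|\boldsymbol{y}_{j-1}\|^2)^{n_j/2}C^{(\lambda_j)}_{n_j}\big(y_j/\sqrt{1-\|\boldsymbol{y}_{j-1}\|^2}\big)$ with $\lambda_j=\mu+|\mathbf{n}^{j+1}|+\frac{s-j}{2}$. For $s\ge1$, real $a,\mu$, $\mathbf{k}=(k_1,\dots,k_s)\in\mathbb{N}_0^s$ and real $y_1,\dots,y_s$, define $f_s(y_1,\dots,y_s;k_1,\dots,k_s,a,\mu)=\prod_{j=1}^{s}(1-\tanh^2 y_j)^{a+\frac{s-j}{4}}\,P^{\mu}_{\mathbf{k}}(\upsilon_1,\dots,\upsilon_s)$, where $\upsilon_1=\tanh y_1$ and $\upsilon_j=\tanh y_j\sqrt{(1-\tanh^2y_1)\cdots(1-\tanh^2 y_{j-1})}$ for $j\ge2$. Convention: $f_0\equiv 1$ with Fourier transform equal to $1$ (relevant only when $r=1$). Fourier transform in $s$ variables: $\mathcal{F}(f)(\xi_1,\dots,\xi_s)=\int_{\mathbb{R}^s}e^{-i(\xi_1y_1+\cdots+\xi_sy_s)}f(y_1,\dots,y_s)\,dy_1\cdots dy_s$.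
   Formalization: The parameter a is assumed positive, since for a ≤ 0 the Fourier integral diverges (e.g. r=1, n=0, a=0) unless the polynomial vanishes identically; the integral over R^r is taken as an iterated improper integral. *)

(* Defs.v *)
From Stdlib Require Import Reals List Factorial.
From Coquelicot Require Import Coquelicot.
Open Scope R_scope.

Fixpoint pochR (x : R) (n : nat) : R :=
  match n with O => 1 | S m => pochR x m * (x + INR m) end.
Fixpoint pochC (z : C) (n : nat) : C :=
  match n with O => RtoC 1 | S m => Cmult (pochC z m) (Cplus z (RtoC (INR m))) end.

(** Terminating 2F1(-n, b; c | x) (real): the series stops at k = n
    since (-n)_k = 0 for k > n. *)
Definition hyp2F1 (n : nat) (b c x : R) : R :=
  sum_n (fun k => pochR (- INR n) k * pochR b k / pochR c k
                   * x ^ k / INR (fact k)) n.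

Definition hyp3F2 (n : nat) (a2 a3 b1 b2 x : C) : C :=
  @sum_n C_AbelianMonoid (fun k =>
     Cdiv (Cmult (Cmult (Cmult (pochC (RtoC (- INR n)) k) (pochC a2 k)) (pochC a3 k))
                 (Cpow x k))
          (Cmult (Cmult (pochC b1 k) (pochC b2 k)) (RtoC (INR (fact k))))) n.

Definition gegenbauer (n : nat) (lam x : R) : R :=
  pochR (2 * lam) n / INR (fact n) * hyp2F1 n (INR n + 2 * lam) (lam + / 2) ((1 - x) / 2).

Fixpoint prodR (f : nat -> R) (m : nat) : R :=
  match m with O => 1 | S p => prodR f p * f p end.

Fixpoint sumR (f : nat -> R) (m : nat) : R :=
  match m with O => 0 | S p => sumR f p + f p end.

(** Ball polynomial P^mu_n(y) in s = length n variables; index j (1-based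
    in the paper) is j0 = j-1 here; y_j is nth j0 y 0. *)
Definition ball_poly (mu : R) (n : list nat) (y : list R) : R :=
  let s := length n in
  prodR (fun j0 =>
    let nj := nth j0 n O in
    let lam := mu + INR (list_sum (skipn (S j0) n)) + (INR s - INR (S j0)) / 2 in
    let nrm2 := sumR (fun i => (nth i y 0) ^ 2) j0 in
    (sqrt (1 - nrm2)) ^ nj * gegenbauer nj lam (nth j0 y 0 / sqrt (1 - nrm2))) s.

Definition fball (y : list R) (k : list nat) (a mu : R) : R :=
  let s := length k in
  let ups := map (fun j0 => tanh (nth j0 y 0) *
                     sqrt (prodR (fun i => 1 - (tanh (nth i y 0)) ^ 2) j0))
                 (seq 0 s) in
  prodR (fun j0 => Rpower (1 - (tanh (nth j0 y 0)) ^ 2)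
                          (a + (INR s - INR (S j0)) / 4)) s
  * ball_poly mu k ups.

Definition expi (t : R) : C := (cos t, sin t).

Fixpoint fourier (g : list R -> C) (xi : list R) : C :=
  match xi with
  | nil => g nil
  | x1 :: xs =>
      @RInt_gen C_R_CompleteNormedModule
        (fun y1 => Cmult (expi (- (x1 * y1))) (fourier (fun ys => g (y1 :: ys)) xs))
        (Rbar_locally m_infty) (Rbar_locally p_infty)
  end.

Definition cpow_pos (t : R) (w : C) : C :=
  Cmult (RtoC (exp (fst w * ln t))) (expi (snd w * ln t)).

(** Euler Gamma function, Re z > 0. *)
Definition CGamma (z : C) : C :=
  @RInt_gen C_R_CompleteNormedModule
    (fun t => Cmult (cpow_pos t (Cminus z (RtoC 1))) (RtoC (exp (- t))))
    (at_right 0) (Rbar_locally p_infty).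

Definition CBeta (p q : C) : C := Cdiv (Cmult (CGamma p) (CGamma q)) (CGamma (Cplus p q)).

(* Main.v *)
Require Import Defs.
From Stdlib Require Import Reals List Factorial Lra Lia FunctionalExtensionality.
From Coquelicot Require Import Coquelicot.
Open Scope R_scope.

(** Since 1 - |upsilon_1|^2 - ... - |upsilon_j|^2 is the product of the
    1 - tanh^2 y_i for i <= j, the function f_r is a product of functions of one
    variable, (1 - tanh^2 y_j)^alpha_j C_{n_j}^{lambda_j}(tanh y_j) with
    alpha_j = a + |n^{j+1}|/2 + (r-j)/4, so its Fourier transform is a product of
    one-dimensional ones; both recursions follow. Expanding the Gegenbauer polynomial
    in powers of (1 - tanh y)/2 = 1/(1 + e^{2y}), each term is, with w = 2y, the beta
    integral of e^{qw} (1 + e^w)^{-s}, whose value Gamma(s-q) Gamma(q) / Gamma(s)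
    comes from exchanging the order of integration in a double integral. *)

(** [RInt_gen] assigns a value to divergent integrals too, so every evaluation must carry
    convergence. The hypothesis [0 < a] supplies it: each alpha_j is at least [a], and alpha_j is
    the real part of both beta arguments. Nothing is assumed of [mu], so a denominator (lambda_j +
    1/2)_k may vanish; division by zero follows the same convention in R and in C, and the identity
    survives term by term. As [fourier] is an iterated integral, pulling out constants is enough
    there; integrals are exchanged only for the beta integral. To make that exchange elementary,
    Euler's integral is moved to the whole line by t = e^u: the Gamma and beta integrands are then
    bounded by multiples of exp(-c |u|) with c > 0, and existence, truncation errors and exchange
    all follow from such bounds. The exponent s = 2 alpha_j + k is real, so Gamma occurs in
    denominators only at positive reals, where its integrand is positive. *)

(** * Convergent integrals over the real line *)

(* Convergence is expressed through a primitive with finite limits at both ends. *)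
Definition line_int (g : R -> R) (l : R) : Prop :=
  (forall x, continuous g x) /\
  exists (P : R -> R) (lm lp : R),
    (forall x, is_derive P x (g x)) /\
    is_lim P m_infty lm /\ is_lim P p_infty lp /\ l = lp - lm.

Lemma line_int_ext (f g : R -> R) (l : R) :
  (forall x, f x = g x) -> line_int f l -> line_int g l.
Proof.
  intros E [Hc [P [lm [lp [Hd H]]]]]. split.
  - intros x. now apply (continuous_ext f).
  - exists P, lm, lp. split; [|exact H]. intros x. rewrite <- E. apply Hd.
Qed.

Lemma line_int_plus (f g : R -> R) (lf lg : R) :
  line_int f lf -> line_int g lg -> line_int (fun x => f x + g x) (lf + lg).
Proof.
  intros [Hc [P [lm [lp [Hd [H1 [H2 ->]]]]]]] [Hc' [P' [lm' [lp' [Hd' [H1' [H2' ->]]]]]]].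
  split.
  - intros x. apply (continuous_plus f g); auto.
  - exists (fun x => P x + P' x), (lm + lm'), (lp + lp'). refine (conj _ (conj _ (conj _ _))).
    + intros x. apply (is_derive_plus P P'); auto.
    + now apply is_lim_plus'.
    + now apply is_lim_plus'.
    + ring.
Qed.

Lemma line_int_scal (c : R) (f : R -> R) (l : R) :
  line_int f l -> line_int (fun x => c * f x) (c * l).
Proof.
  intros [Hc [P [lm [lp [Hd [H1 [H2 ->]]]]]]]. split.
  - intros x. apply (continuous_scal_r c f); auto.
  - exists (fun x => c * P x), (c * lm), (c * lp). refine (conj _ (conj _ (conj _ _))).
    + intros x. apply (is_derive_scal P x c); auto.
    + apply (is_lim_scal_l P c m_infty lm H1).
    + apply (is_lim_scal_l P c p_infty lp H2).
    + ring.
Qed.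

Lemma is_lim_affine_p (k c : R) :
  0 < k -> is_lim (fun x => k * x + c) p_infty p_infty.
Proof.
  intros Hk. apply (is_lim_spec (fun x => k * x + c) p_infty p_infty).
  intros M. exists ((M - c) / k). intros x Hx.
  apply (Rmult_lt_compat_l k) in Hx; [|lra].
  replace (k * ((M - c) / k)) with (M - c) in Hx by (field; lra). lra.
Qed.

Lemma is_lim_affine_m (k c : R) :
  0 < k -> is_lim (fun x => k * x + c) m_infty m_infty.
Proof.
  intros Hk. apply (is_lim_spec (fun x => k * x + c) m_infty m_infty).
  intros M. exists ((M - c) / k). intros x Hx.
  apply (Rmult_lt_compat_l k) in Hx; [|lra].
  replace (k * ((M - c) / k)) with (M - c) in Hx by (field; lra). lra.
Qed.

Lemma line_int_affine (k c : R) (f : R -> R) (l : R) :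
  0 < k -> line_int f l -> line_int (fun x => f (k * x + c)) (l / k).
Proof.
  intros Hk [Hc [P [lm [lp [Hd [H1 [H2 ->]]]]]]].
  assert (D : forall x, is_derive (fun x => k * x + c) x k).
  { intros x. auto_derive; [trivial|ring]. }
  split.
  - intros x. apply (continuous_comp (fun x => k * x + c) f); [|apply Hc].
    apply (ex_derive_continuous (fun x => k * x + c)). eexists; apply D.
  - exists (fun x => / k * P (k * x + c)), (/ k * lm), (/ k * lp). refine (conj _ (conj _ (conj _ _))).
    + intros x. replace (f (k * x + c)) with (/ k * (k * f (k * x + c))) by (field; lra).
      apply (is_derive_scal (fun x => P (k * x + c)) x (/ k)).
      apply (is_derive_comp P (fun x => k * x + c)); [apply Hd|apply D].
    + apply (is_lim_scal_l _ (/ k) m_infty lm).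
      exact (filterlim_comp _ _ _ _ _ _ _ _ (is_lim_affine_m k c Hk) H1).
    + apply (is_lim_scal_l _ (/ k) p_infty lp).
      exact (filterlim_comp _ _ _ _ _ _ _ _ (is_lim_affine_p k c Hk) H2).
    + field; lra.
Qed.

Lemma derive_nonneg_le (f df : R -> R) (x y : R) :
  x <= y ->
  (forall t, x <= t <= y -> is_derive f t (df t)) ->
  (forall t, x <= t <= y -> 0 <= df t) -> f x <= f y.
Proof.
  intros Hxy Hd Hp.
  destruct (MVT_gen f x y df) as [t [Ht E]].
  - intros t Ht. rewrite Rmin_left, Rmax_right in Ht by lra. apply Hd; lra.
  - intros t Ht. rewrite Rmin_left, Rmax_right in Ht by lra.
    apply continuity_pt_filterlim, (ex_derive_continuous f).
    exists (df t). apply Hd; lra.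
  - rewrite Rmin_left, Rmax_right in Ht by lra.
    assert (0 <= df t * (y - x)) by (apply Rmult_le_pos; [apply Hp|]; lra). lra.
Qed.

(** The function [h] is a primitive of the dominating exponential, so [h - P] and [h + P] are both
    nondecreasing on [x, y]. Hence the increment of [P] is at most that of [h], and [h y <= 0]. *)
Lemma primitive_tail (P g : R -> R) (M e x y : R) :
  0 < e -> 0 <= M -> (forall t, is_derive P t (g t)) ->
  (forall t, Rabs (g t) <= M * exp (- (e * Rabs t))) ->
  0 <= x <= y -> Rabs (P y - P x) <= M / e * exp (- (e * x)).
Proof.
  intros He HM Hd Hb Hxy.
  set (h := fun t => - (M / e) * exp (- (e * t))).
  assert (Dh : forall t, is_derive h t (M * exp (- (e * t)))).
  { intros t. unfold h. auto_derive; [trivial|field; lra]. }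
  assert (B : forall t, x <= t <= y -> Rabs (g t) <= M * exp (- (e * t))).
  { intros t Ht. rewrite <- (Rabs_pos_eq t) at 2 by lra. apply Hb. }
  assert (h x - P x <= h y - P y).
  { apply (derive_nonneg_le (fun t => h t - P t) (fun t => M * exp (- (e * t)) - g t));
      [lra| |].
    - intros t _. apply (is_derive_minus h P); auto.
    - intros t Ht. specialize (B t Ht). apply Rabs_le_between in B. lra. }
  assert (h x + P x <= h y + P y).
  { apply (derive_nonneg_le (fun t => h t + P t) (fun t => M * exp (- (e * t)) + g t));
      [lra| |].
    - intros t _. apply (is_derive_plus h P); auto.
    - intros t Ht. specialize (B t Ht). apply Rabs_le_between in B. lra. }
  assert (0 <= M / e * exp (- (e * y))).
  { apply Rmult_le_pos; [apply Rdiv_le_0_compat; lra|left; apply exp_pos]. }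
  unfold h in *. apply Rabs_le; lra.
Qed.

(** Reduces every statement about the left end of the line to one about the right end. *)
Lemma is_derive_reflect (P g : R -> R) :
  (forall t, is_derive P t (g t)) ->
  forall t, is_derive (fun t => - P (- t)) t (g (- t)).
Proof.
  intros Hd t. replace (g (- t)) with (- (- 1 * g (- t))) by ring.
  apply (is_derive_opp (fun t => P (- t))).
  apply (is_derive_comp P (fun t => - t)); [apply Hd|].
  auto_derive; [trivial|ring].
Qed.

Lemma exp_decay_lim (C e : R) :
  0 < e -> is_lim (fun x => C * exp (- (e * x))) p_infty 0.
Proof.
  intros He. replace (Finite 0) with (Rbar_mult C 0) by (simpl; now rewrite Rmult_0_r).
  apply is_lim_scal_l.
  refine (filterlim_comp _ _ _ (fun x => - (e * x)) exp _ (Rbar_locally m_infty) _ _ is_lim_exp_m).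
  apply (is_lim_spec (fun x => - (e * x)) p_infty m_infty). intros M.
  exists (- M / e). intros x Hx.
  apply (Rmult_lt_compat_l e) in Hx; [|lra].
  replace (e * (- M / e)) with (- M) in Hx by (field; lra). lra.
Qed.

Lemma primitive_lim_p (P g : R -> R) (M e : R) :
  0 < e -> 0 <= M -> (forall t, is_derive P t (g t)) ->
  (forall t, Rabs (g t) <= M * exp (- (e * Rabs t))) ->
  exists l : R, is_lim P p_infty l.
Proof.
  intros He HM Hd Hb.
  apply (filterlim_locally_cauchy (U := R_CompleteSpace) (F := Rbar_locally p_infty) P).
  intros eps.
  destruct (proj2 (is_lim_spec _ p_infty 0) (exp_decay_lim (M / e) e He) eps) as [x0 Hx0].
  (* The maximum with 0 is there because [primitive_tail] bounds increments on the positive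
     half-line only. *)
  exists (fun x => Rmax x0 0 < x). split.
  { exists (Rmax x0 0). auto. }
  assert (W : forall u v, Rmax x0 0 < u -> u <= v -> Rabs (P v - P u) < eps).
  { intros u v Hu Huv. assert (Hm := Rmax_l x0 0). assert (Hm' := Rmax_r x0 0).
    eapply Rle_lt_trans; [apply (primitive_tail P g M e); auto; lra|].
    specialize (Hx0 u ltac:(lra)). rewrite Rminus_0_r in Hx0.
    eapply Rle_lt_trans; [apply Rle_abs|exact Hx0]. }
  intros u v Hu Hv. change (Rabs (P v - P u) < eps).
  destruct (Rle_lt_dec u v).
  - now apply W.
  - rewrite Rabs_minus_sym. apply W; lra.
Qed.

Lemma line_int_exists (g : R -> R) (M e : R) :
  0 < e -> 0 <= M -> (forall x, continuous g x) ->
  (forall t, Rabs (g t) <= M * exp (- (e * Rabs t))) ->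
  exists l, line_int g l.
Proof.
  intros He HM Hc Hb.
  assert (Hd : forall t, is_derive (RInt g 0) t (g t)).
  { intros t. apply (is_derive_RInt g (RInt g 0) 0); [|apply Hc].
    apply filter_forall. intros u. apply (RInt_correct (V := R_CompleteNormedModule) g 0 u), ex_RInt_continuous; auto. }
  destruct (primitive_lim_p (RInt g 0) g M e He HM Hd Hb) as [lp Hp].
  destruct (primitive_lim_p (fun t => - RInt g 0 (- t)) (fun t => g (- t)) M e He HM)
    as [lm Hm].
  - now apply is_derive_reflect.
  - intros t. rewrite <- (Rabs_Ropp t). apply Hb.
  (* Here [lm] is the limit of the reflected primitive at plus infinity, so the primitive itself
     tends to [- lm] at minus infinity. *)
  - exists (lp - - lm). split; [exact Hc|].
    exists (RInt g 0), (- lm), lp. refine (conj _ (conj _ (conj _ _))); auto.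
    apply (is_lim_ext (fun x => - (- RInt g 0 (- (- x))))).
    { intros x. now rewrite !Ropp_involutive. }
    apply (is_lim_opp _ _ lm).
    refine (filterlim_comp _ _ _ Ropp (fun t => - RInt g 0 (- t)) _ (Rbar_locally p_infty) _ _ Hm).
    apply (is_lim_spec Ropp m_infty p_infty). intros A. exists (- A). intros x Hx. lra.
Qed.

Lemma RInt_primitive (P g : R -> R) (a b : R) :
  (forall t, is_derive P t (g t)) -> (forall x, continuous g x) ->
  RInt g a b = P b - P a.
Proof.
  intros Hd Hc. apply is_RInt_unique. apply (is_RInt_derive P g); auto.
Qed.

Lemma line_int_tail (g : R -> R) (l M e m : R) :
  0 < e -> 0 <= M -> line_int g l ->
  (forall t, Rabs (g t) <= M * exp (- (e * Rabs t))) -> 0 <= m ->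
  Rabs (l - RInt g (- m) m) <= 2 * (M / e * exp (- (e * m))).
Proof.
  intros He HM [Hc [P [lm [lp [Hd [H1 [H2 ->]]]]]]] Hb Hm.
  rewrite (RInt_primitive P g) by auto.
  assert (T1 : forall y, m <= y -> Rabs (P y - P m) <= M / e * exp (- (e * m))).
  { intros y Hy. apply (primitive_tail P g); auto; lra. }
  assert (T2 : forall y, m <= y -> Rabs (P (- y) - P (- m)) <= M / e * exp (- (e * m))).
  { intros y Hy. replace (P (- y) - P (- m)) with (- (- P (- y) - - P (- m))) by ring.
    rewrite Rabs_Ropp.
    apply (primitive_tail (fun t => - P (- t)) (fun t => g (- t)) M e m y); auto; try lra.
    - now apply is_derive_reflect.
    - intros t. rewrite <- (Rabs_Ropp t). apply Hb. }
  (* The bound [T1] is uniform in [y], so it passes to the limit; [B2] does the same at the left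
     end. *)
  assert (B1 : Rabs (lp - P m) <= M / e * exp (- (e * m))).
  { apply (is_lim_le_loc (fun y => Rabs (P y - P m)) (fun _ => M / e * exp (- (e * m))) p_infty
             (Rabs (lp - P m)) (M / e * exp (- (e * m)))).
    - exists m. intros y Hy. apply T1; lra.
    - refine (filterlim_comp _ _ _ (fun y => P y - P m) Rabs (Rbar_locally p_infty)
                _ _ _ (continuous_Rabs (lp - P m))).
      apply (is_lim_minus' P (fun _ => P m) p_infty); [exact H2|apply is_lim_const].
    - apply is_lim_const. }
  assert (B2 : Rabs (lm - P (- m)) <= M / e * exp (- (e * m))).
  { apply (is_lim_le_loc (fun y => Rabs (P y - P (- m))) (fun _ => M / e * exp (- (e * m))) m_infty
             (Rabs (lm - P (- m))) (M / e * exp (- (e * m)))).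
    - exists (- m). intros y Hy. rewrite <- (Ropp_involutive y). apply T2; lra.
    - refine (filterlim_comp _ _ _ (fun y => P y - P (- m)) Rabs (Rbar_locally m_infty)
                _ _ _ (continuous_Rabs (lm - P (- m)))).
      apply (is_lim_minus' P (fun _ => P (- m)) m_infty); [exact H1|apply is_lim_const].
    - apply is_lim_const. }
  apply Rabs_le_between in B1. apply Rabs_le_between in B2. apply Rabs_le; lra.
Qed.

(** Symmetric truncations do not mention the primitive, so they yield uniqueness of the value and a
    common ground for comparing two iterated integrals. *)
Lemma line_int_sym (g : R -> R) (l : R) :
  line_int g l -> is_lim (fun m => RInt g (- m) m) p_infty l.
Proof.
  intros [Hc [P [lm [lp [Hd [H1 [H2 ->]]]]]]].
  apply (is_lim_ext (fun m => P m - P (- m))).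
  { intros m. now rewrite (RInt_primitive P g). }
  apply is_lim_minus'; [exact H2|].
  refine (filterlim_comp _ _ _ Ropp P _ (Rbar_locally m_infty) _ _ H1).
  apply (is_lim_spec Ropp p_infty m_infty). intros A. exists (- A). intros x Hx. lra.
Qed.

Lemma line_int_unique (g : R -> R) (l l' : R) : line_int g l -> line_int g l' -> l = l'.
Proof.
  intros H H'. apply line_int_sym in H, H'.
  apply is_lim_unique in H, H'. congruence.
Qed.

Lemma exp_le (x y : R) : x <= y -> exp x <= exp y.
Proof.
  intros [H|<-]; [left; now apply exp_increasing|right; reflexivity].
Qed.

(** * Exchange of integrals over the plane *)

Lemma continuity_2d_swap (K : R -> R -> R) (x y : R) :
  continuity_2d_pt K x y -> continuity_2d_pt (fun v u => K u v) y x.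
Proof.
  intros H eps. destruct (H eps) as [d Hd]. exists d. intros u v Hu Hv. now apply Hd.
Qed.

Lemma continuity_2d_slice (K : R -> R -> R) (x y : R) :
  continuity_2d_pt K x y -> continuous (K x) y.
Proof.
  intros H. apply continuity_pt_filterlim. intros eps Heps.
  destruct (H (mkposreal eps Heps)) as [d Hd]. exists d. split; [apply cond_pos|].
  intros v [_ Hv]. apply Hd; [rewrite Rminus_diag, Rabs_R0; apply cond_pos|exact Hv].
Qed.

Lemma RInt_param_continuous_le (K : R -> R -> R) (c d : R) :
  c <= d -> (forall x y, continuity_2d_pt K x y) ->
  forall x, continuous (fun x => RInt (K x) c d) x.
Proof.
  intros Hcd HK x. apply continuity_pt_filterlim. intros eps Heps.
  (* Adding 1 to the length keeps the divisor positive when [c = d] and makes the final bound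
     strictly smaller than [eps]. *)
  assert (Hp : 0 < eps / (d - c + 1)) by (apply Rdiv_lt_0_compat; lra).
  destruct (uniform_continuity_2d_1d' K c d x (fun y _ => HK x y) (mkposreal _ Hp))
    as [del Hdel].
  assert (Ex : forall z, ex_RInt (K z) c d).
  { intros z. apply (ex_RInt_continuous (V := R_CompleteNormedModule)).
    intros t _. now apply continuity_2d_slice. }
  exists del. split; [apply cond_pos|]. intros z [_ Hz].
  change (Rabs (RInt (K z) c d - RInt (K x) c d) < eps).
  change (Rabs (z - x) < del) in Hz. apply Rabs_lt_between' in Hz.
  rewrite <- (RInt_minus (V := R_CompleteNormedModule)) by auto.
  apply Rle_lt_trans with ((d - c) * (eps / (d - c + 1))).
  - apply abs_RInt_le_const; auto.
    + apply (ex_RInt_minus (V := R_NormedModule)); auto.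
    + intros t Ht. left. assert (Hd0 := cond_pos del).
      apply (Hdel t x t z); try lra.
      rewrite Rminus_diag, Rabs_R0. apply cond_pos.
  - replace eps with ((d - c + 1) * (eps / (d - c + 1))) at 2 by (field; lra).
    apply Rmult_lt_compat_r; lra.
Qed.

(** Reversed bounds occur in [RInt_swap], where the inner integral runs from [a] to an arbitrary
    [y]. *)
Lemma RInt_param_continuous (K : R -> R -> R) (c d : R) :
  (forall x y, continuity_2d_pt K x y) ->
  forall x, continuous (fun x => RInt (K x) c d) x.
Proof.
  intros HK x. destruct (Rle_lt_dec c d) as [H|H].
  - now apply RInt_param_continuous_le.
  - apply (continuous_ext (fun x => - RInt (K x) d c)).
    + intros z. apply (opp_RInt_swap (V := R_CompleteNormedModule)).
      apply (ex_RInt_continuous (V := R_CompleteNormedModule)).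
      intros t _. now apply continuity_2d_slice.
    + apply (continuous_opp (fun x => RInt (K x) d c)).
      apply RInt_param_continuous_le; [lra|exact HK].
Qed.

(* Both sides are functions of [b] vanishing at [a] with the same derivative. *)
Lemma RInt_swap (K : R -> R -> R) (a b c d : R) :
  a <= b -> c <= d -> (forall x y, continuity_2d_pt K x y) ->
  RInt (fun u => RInt (K u) c d) a b = RInt (fun w => RInt (fun u => K u w) a b) c d.
Proof.
  intros Hab Hcd HK.
  set (L := fun x => RInt (fun u => RInt (K u) c d) a x).
  set (F := fun x => RInt (fun w => RInt (fun u => K u w) a x) c d).
  change (L b = F b).
  assert (Sw : forall w x y, ex_RInt (fun u => K u w) x y).
  { intros w x y. apply (ex_RInt_continuous (V := R_CompleteNormedModule)). intros t _.
    apply (continuity_2d_slice (fun v u => K u v)). now apply continuity_2d_swap. }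
  assert (D : forall w x, is_derive (fun x => RInt (fun u => K u w) a x) x (K x w)).
  { intros w x. apply (is_derive_RInt (fun u => K u w) _ a).
    - apply filter_forall. intros y.
      now apply (RInt_correct (V := R_CompleteNormedModule)).
    - apply (continuity_2d_slice (fun v u => K u v)). now apply continuity_2d_swap. }
  assert (DL : forall x, is_derive L x (RInt (K x) c d)).
  { intros x. apply (is_derive_RInt (fun u => RInt (K u) c d) L a).
    - apply filter_forall. intros y.
      apply (RInt_correct (V := R_CompleteNormedModule)), ex_RInt_continuous.
      intros z _. now apply RInt_param_continuous.
    - now apply RInt_param_continuous. }
  assert (DF : forall x, is_derive F x (RInt (K x) c d)).
  { intros x. unfold F.
    (* Differentiation under the integral sign yields the integral of the partial derivative,
       written with [Derive]; by [D] that partial derivative is [K x t]. *)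
    replace (RInt (K x) c d)
      with (RInt (fun t => Derive (fun u => (fun u w => RInt (fun v => K v w) a u) u t) x) c d).
    2:{ apply RInt_ext. intros t _. apply is_derive_unique, D. }
    apply (is_derive_RInt_param (fun x w => RInt (fun u => K u w) a x)).
    - apply filter_forall. intros y t _. eexists; apply D.
    - intros t _. apply (continuity_2d_pt_ext K); [|apply HK].
      intros u v. symmetry. apply is_derive_unique, D.
    - apply filter_forall. intros y.
      apply (ex_RInt_continuous (V := R_CompleteNormedModule)). intros z _.
      apply (RInt_param_continuous (fun w u => K u w)).
      intros u v. now apply continuity_2d_swap. }
  assert (E0 : L a - F a = 0).
  { unfold L, F. rewrite RInt_point.
    rewrite (RInt_ext _ (fun _ => 0)).
    - rewrite RInt_const. change (0 - (d - c) * 0 = 0). ring.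
    - intros w _. exact (RInt_point a (fun u => K u w)). }
  destruct (Rle_lt_or_eq_dec a b Hab) as [Hlt|<-]; [|lra].
  enough (L a - F a = L b - F b) by lra.
  apply (eq_is_derive (V := R_NormedModule) (fun x => L x - F x)); [|exact Hlt].
  intros t _. assert (X := is_derive_minus L F t _ _ (DL t) (DF t)).
  rewrite minus_eq_zero in X. exact X.
Qed.

Lemma RInt_sym_close (f g : R -> R) (D m : R) :
  0 <= m -> (forall x, continuous f x) -> (forall x, continuous g x) ->
  (forall u, Rabs (f u - g u) <= D) ->
  Rabs (RInt f (- m) m - RInt g (- m) m) <= 2 * m * D.
Proof.
  intros Hm Hf Hg HD.
  assert (Ef : ex_RInt f (- m) m).
  { apply (ex_RInt_continuous (V := R_CompleteNormedModule)); auto. }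
  assert (Eg : ex_RInt g (- m) m).
  { apply (ex_RInt_continuous (V := R_CompleteNormedModule)); auto. }
  rewrite <- (RInt_minus (V := R_CompleteNormedModule) f g) by assumption.
  replace (2 * m) with (m - - m) by ring.
  apply abs_RInt_le_const; [lra| |].
  - now apply (ex_RInt_minus (V := R_NormedModule)).
  - intros t _. apply HD.
Qed.

(** Exponential decay beats the factor [m] that integrating a truncation error over [-m, m]
    produces. The substitution y = - e x reduces it to y e^y at minus infinity. *)
Lemma id_exp_decay_lim (C e : R) :
  0 < e -> is_lim (fun x => C * (x * exp (- (e * x)))) p_infty 0.
Proof.
  intros He.
  assert (H : is_lim (fun x => - (e * x) * exp (- (e * x))) p_infty 0).
  { refine (filterlim_comp _ _ _ (fun x => - (e * x)) (fun y => y * exp y) _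
              (Rbar_locally m_infty) _ _ is_lim_mul_exp_m).
    apply (is_lim_spec (fun x => - (e * x)) p_infty m_infty). intros M.
    exists (- M / e). intros x Hx.
    apply (Rmult_lt_compat_l e) in Hx; [|lra].
    replace (e * (- M / e)) with (- M) in Hx by (field; lra). lra. }
  apply (is_lim_scal_l _ (- C / e)) in H.
  replace (Rbar_mult (- C / e) 0) with (Finite 0) in H by (simpl; now rewrite Rmult_0_r).
  eapply is_lim_ext; [|exact H]. intros x. cbv beta. field. lra.
Qed.

(* The two iterated integrals are limits of the integrals over the squares
   [[-m,m]^2], with errors [O(m exp(-e m))]. *)
Lemma line_int_fubini (K : R -> R -> R) (A B : R -> R) (IA IB M e : R) :
  0 < e -> 0 <= M -> (forall x y, continuity_2d_pt K x y) ->
  (forall u w, Rabs (K u w) <= M * exp (- (e * Rabs u)) * exp (- (e * Rabs w))) ->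
  (forall u, line_int (K u) (A u)) -> (forall w, line_int (fun u => K u w) (B w)) ->
  line_int A IA -> line_int B IB -> IA = IB.
Proof.
  intros He HM HK Hb HA HB HIA HIB.
  assert (E1 : forall t, exp (- (e * Rabs t)) <= 1).
  { intros t. rewrite <- exp_0. apply exp_le.
    assert (0 <= e * Rabs t) by (apply Rmult_le_pos; [lra|apply Rabs_pos]). lra. }
  (* Dropping the decay in the other variable gives one truncation bound valid for all [u]; the
     price is the factor [m] in the error. *)
  assert (B1 : forall u t, Rabs (K u t) <= M * exp (- (e * Rabs t))).
  { intros u t. eapply Rle_trans; [apply Hb|].
    apply Rmult_le_compat_r; [left; apply exp_pos|].
    rewrite <- (Rmult_1_r M) at 2. now apply Rmult_le_compat_l. }
  assert (B2 : forall w t, Rabs (K t w) <= M * exp (- (e * Rabs t))).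
  { intros w t. eapply Rle_trans; [apply Hb|].
    rewrite <- (Rmult_1_r (M * _)) at 2. apply Rmult_le_compat_l; [|apply E1].
    apply Rmult_le_pos; [lra|left; apply exp_pos]. }
  assert (HK' : forall x y, continuity_2d_pt (fun w u => K u w) x y).
  { intros x y. now apply continuity_2d_swap. }
  assert (Z : is_lim (fun m => RInt A (- m) m - RInt B (- m) m) p_infty 0).
  { apply (is_lim_le_le_loc (fun m => - (8 * M / e) * (m * exp (- (e * m))))
             (fun m => (8 * M / e) * (m * exp (- (e * m))))).
    - exists 0. intros m Hm.
      assert (TA : Rabs (RInt A (- m) m - RInt (fun u => RInt (K u) (- m) m) (- m) m)
                   <= 2 * m * (2 * (M / e * exp (- (e * m))))).
      { apply RInt_sym_close; [lra|apply HIA|now apply RInt_param_continuous|].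
        intros u. apply (line_int_tail (K u)); auto; lra. }
      assert (TB : Rabs (RInt B (- m) m
                         - RInt (fun w => RInt (fun u => K u w) (- m) m) (- m) m)
                   <= 2 * m * (2 * (M / e * exp (- (e * m))))).
      { apply RInt_sym_close;
          [lra|apply HIB|now apply (RInt_param_continuous (fun w u => K u w))|].
        intros w. apply (line_int_tail (fun u => K u w)); auto; lra. }
      rewrite (RInt_swap K (- m) m (- m) m) in TA by (auto; lra).
      apply Rabs_le_between in TA. apply Rabs_le_between in TB.
      replace (2 * m * (2 * (M / e * exp (- (e * m)))))
        with ((4 * M / e) * (m * exp (- (e * m)))) in TA, TB by (field; lra).
      replace (8 * M / e) with (4 * M / e + 4 * M / e) by (field; lra).
      lra.
    - now apply id_exp_decay_lim.
    - now apply id_exp_decay_lim. }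
  (* The same difference tends to [IA - IB] and, by [Z], to 0. *)
  assert (Z' := is_lim_minus' _ _ _ _ _ (line_int_sym _ _ HIA) (line_int_sym _ _ HIB)).
  apply is_lim_unique in Z, Z'. rewrite Z in Z'. injection Z' as Z'. lra.
Qed.

(** * Complex-valued integrands *)

Definition cline_int (g : R -> C) (l : C) : Prop :=
  line_int (fun x => fst (g x)) (fst l) /\ line_int (fun x => snd (g x)) (snd l).

Lemma cline_int_ext (f g : R -> C) (l : C) :
  (forall x, f x = g x) -> cline_int f l -> cline_int g l.
Proof.
  intros E [H1 H2]. split; eapply line_int_ext; try eassumption;
    intros x; cbv beta; now rewrite E.
Qed.

Lemma cline_int_unique (g : R -> C) (l l' : C) : cline_int g l -> cline_int g l' -> l = l'.
Proof.
  intros [H1 H2] [H1' H2']. destruct l, l'.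
  f_equal; [exact (line_int_unique _ _ _ H1 H1')|exact (line_int_unique _ _ _ H2 H2')].
Qed.

Lemma cline_int_plus (f g : R -> C) (lf lg : C) :
  cline_int f lf -> cline_int g lg -> cline_int (fun x => Cplus (f x) (g x)) (Cplus lf lg).
Proof. intros [H1 H2] [H1' H2']. split; now apply line_int_plus. Qed.

Lemma cline_int_scal (c : C) (f : R -> C) (l : C) :
  cline_int f l -> cline_int (fun x => Cmult c (f x)) (Cmult c l).
Proof.
  intros [H1 H2]. split; simpl.
  - apply (line_int_ext (fun x => fst c * fst (f x) + - snd c * snd (f x))).
    { intros x; ring. }
    replace (fst c * fst l - snd c * snd l) with (fst c * fst l + - snd c * snd l) by ring.
    apply line_int_plus; now apply line_int_scal.
  - apply line_int_plus; now apply line_int_scal.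
Qed.

Lemma cline_int_scal_r (c : C) (f : R -> C) (l : C) :
  cline_int f l -> cline_int (fun x => Cmult (f x) c) (Cmult l c).
Proof.
  intros H. rewrite Cmult_comm. apply (cline_int_ext (fun x => Cmult c (f x))).
  - intros x. apply Cmult_comm.
  - now apply cline_int_scal.
Qed.

Lemma cline_int_affine (k c : R) (f : R -> C) (l : C) :
  0 < k -> cline_int f l ->
  cline_int (fun x => f (k * x + c)) (Cmult (RtoC (/ k)) l).
Proof.
  intros Hk [H1 H2]. split; simpl.
  - replace (/ k * fst l - 0 * snd l) with (fst l / k) by (field; lra).
    now apply (line_int_affine k c (fun x => fst (f x))).
  - replace (/ k * snd l + 0 * fst l) with (snd l / k) by (field; lra).
    now apply (line_int_affine k c (fun x => snd (f x))).
Qed.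

Lemma cline_int_sum_n (f : nat -> R -> C) (l : nat -> C) (n : nat) :
  (forall k, (k <= n)%nat -> cline_int (f k) (l k)) ->
  cline_int (fun x => @sum_n C_AbelianMonoid (fun k => f k x) n)
            (@sum_n C_AbelianMonoid l n).
Proof.
  induction n as [|n IH]; intros H.
  - apply (cline_int_ext (f 0%nat)).
    + intros x. now rewrite sum_O.
    + rewrite sum_O. now apply H.
  - apply (cline_int_ext (fun x => Cplus (@sum_n C_AbelianMonoid (fun k => f k x) n) (f (S n) x))).
    + intros x. now rewrite sum_Sn.
    + rewrite sum_Sn. apply cline_int_plus; [apply IH; intros k Hk|]; apply H; lia.
Qed.

Lemma Rabs_fst_le_Cmod (z : C) : Rabs (fst z) <= Cmod z.
Proof. apply Rle_trans with (2 := Rmax_Cmod z). apply Rmax_l. Qed.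

Lemma Rabs_snd_le_Cmod (z : C) : Rabs (snd z) <= Cmod z.
Proof. apply Rle_trans with (2 := Rmax_Cmod z). apply Rmax_r. Qed.

Lemma cline_int_exists (g : R -> C) (M e : R) :
  0 < e -> 0 <= M ->
  (forall x, continuous (fun x => fst (g x)) x) ->
  (forall x, continuous (fun x => snd (g x)) x) ->
  (forall t, Cmod (g t) <= M * exp (- (e * Rabs t))) ->
  exists l, cline_int g l.
Proof.
  intros He HM H1 H2 Hb.
  destruct (line_int_exists (fun x => fst (g x)) M e) as [l1 L1]; auto.
  { intros t. eapply Rle_trans; [apply Rabs_fst_le_Cmod|apply Hb]. }
  destruct (line_int_exists (fun x => snd (g x)) M e) as [l2 L2]; auto.
  { intros t. eapply Rle_trans; [apply Rabs_snd_le_Cmod|apply Hb]. }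
  now exists (l1, l2).
Qed.

Lemma cline_int_fubini (K : R -> R -> C) (A B : R -> C) (IA IB : C) (M e : R) :
  0 < e -> 0 <= M ->
  (forall x y, continuity_2d_pt (fun u w => fst (K u w)) x y) ->
  (forall x y, continuity_2d_pt (fun u w => snd (K u w)) x y) ->
  (forall u w, Cmod (K u w) <= M * exp (- (e * Rabs u)) * exp (- (e * Rabs w))) ->
  (forall u, cline_int (K u) (A u)) -> (forall w, cline_int (fun u => K u w) (B w)) ->
  cline_int A IA -> cline_int B IB -> IA = IB.
Proof.
  intros He HM C1 C2 Hb HA HB HIA HIB. destruct IA, IB. f_equal.
  - apply (line_int_fubini (fun u w => fst (K u w)) (fun u => fst (A u)) (fun w => fst (B w))
             _ _ M e); auto; try apply HIA; try apply HIB.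
    + intros u w. eapply Rle_trans; [apply Rabs_fst_le_Cmod|apply Hb].
    + intros u. apply HA.
    + intros w. apply HB.
  - apply (line_int_fubini (fun u w => snd (K u w)) (fun u => snd (A u)) (fun w => snd (B w))
             _ _ M e); auto; try apply HIA; try apply HIB.
    + intros u w. eapply Rle_trans; [apply Rabs_snd_le_Cmod|apply Hb].
    + intros u. apply HA.
    + intros w. apply HB.
Qed.

(** * From primitives to improper integrals, with change of variable *)

Lemma primitive_subst_lim (P phi : R -> R) (Fa Fb : (R -> Prop) -> Prop) (lm lp : R)
  {FFa : Filter Fa} {FFb : Filter Fb} :
  filterlim phi Fa (Rbar_locally m_infty) -> filterlim phi Fb (Rbar_locally p_infty) ->
  is_lim P m_infty lm -> is_lim P p_infty lp ->
  filterlim (fun ab : R * R => P (phi (snd ab)) - P (phi (fst ab)))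
    (filter_prod Fa Fb) (locally (lp - lm)).
Proof.
  intros Ha Hb Hm Hp.
  apply (filterlim_comp_2 (G := locally lp) (H := locally (- lm))
           (fun ab : R * R => P (phi (snd ab))) (fun ab : R * R => - P (phi (fst ab))) Rplus).
  - apply (filterlim_comp _ _ _ snd (fun b => P (phi b)) _ Fb); [apply filterlim_snd|].
    exact (filterlim_comp _ _ _ phi P _ _ _ Hb Hp).
  - apply (filterlim_comp _ _ _ (fun ab : R * R => P (phi (fst ab))) Ropp _ (locally lm)).
    + apply (filterlim_comp _ _ _ fst (fun b => P (phi b)) _ Fa); [apply filterlim_fst|].
      exact (filterlim_comp _ _ _ phi P _ _ _ Ha Hm).
    + apply (filterlim_opp (K := R_AbsRing) (V := R_NormedModule) lm).
  - apply (filterlim_plus (K := R_AbsRing) (V := R_NormedModule) lp (- lm)).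
Qed.

Lemma is_RInt_primitive_comp (P g phi dphi : R -> R) (a b : R) :
  (forall t, is_derive P t (g t)) -> (forall x, continuous g x) ->
  (forall t, Rmin a b <= t <= Rmax a b -> is_derive phi t (dphi t) /\ continuous dphi t) ->
  is_RInt (fun t => dphi t * g (phi t)) a b (P (phi b) - P (phi a)).
Proof.
  intros HP Hc Hphi.
  apply (is_RInt_derive (V := R_CompleteNormedModule) (fun t => P (phi t))).
  - intros t Ht. apply (is_derive_comp P phi); [apply HP|now apply Hphi].
  - intros t Ht. destruct (Hphi t Ht) as [Hd Hdc].
    apply (continuous_mult dphi (fun t => g (phi t))); [exact Hdc|].
    apply (continuous_comp phi g); [|apply Hc].
    apply (ex_derive_continuous phi). now exists (dphi t).
Qed.

(** The end filters are general because two substitutions use this lemma: the identity on the whole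
    line, and [ln] from the right of 0 to plus infinity. For [ln], differentiability holds only
    between positive endpoints, so it is required only eventually along the filters. *)
Lemma cline_int_subst (g : R -> C) (l : C) (phi dphi : R -> R) (Fa Fb : (R -> Prop) -> Prop)
  {FFa : Filter Fa} {FFb : Filter Fb} :
  cline_int g l ->
  filterlim phi Fa (Rbar_locally m_infty) -> filterlim phi Fb (Rbar_locally p_infty) ->
  filter_prod Fa Fb (fun ab => forall t, Rmin (fst ab) (snd ab) <= t <= Rmax (fst ab) (snd ab) ->
                      is_derive phi t (dphi t) /\ continuous dphi t) ->
  is_RInt_gen (V := C_R_NormedModule) (fun t => Cmult (RtoC (dphi t)) (g (phi t))) Fa Fb l.
Proof.
  intros [[Hc1 [P1 [lm1 [lp1 [Hd1 [Hm1 [Hp1 E1]]]]]]] [Hc2 [P2 [lm2 [lp2 [Hd2 [Hm2 [Hp2 E2]]]]]]]]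
    Ha Hb Hphi. intros Q [eps HQ].
  assert (L1 := primitive_subst_lim P1 phi Fa Fb lm1 lp1 Ha Hb Hm1 Hp1).
  assert (L2 := primitive_subst_lim P2 phi Fa Fb lm2 lp2 Ha Hb Hm2 Hp2).
  rewrite <- E1 in L1. rewrite <- E2 in L2.
  specialize (L1 _ (locally_ball (fst l) eps)). specialize (L2 _ (locally_ball (snd l) eps)).
  unfold filtermap in L1, L2. unfold filtermapi.
  generalize (filter_and _ _ Hphi (filter_and _ _ L1 L2)). apply filter_imp.
  intros [a b] [H [B1 B2]]. cbn [fst snd] in *.
  exists (P1 (phi b) - P1 (phi a), P2 (phi b) - P2 (phi a)). split.
  - apply (is_RInt_fct_extend_pair (U := R_NormedModule) (V := R_NormedModule)).
    + apply (is_RInt_ext (fun t => dphi t * fst (g (phi t)))).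
      { intros t _. simpl. ring. }
      now apply (is_RInt_primitive_comp P1 (fun x => fst (g x))).
    + apply (is_RInt_ext (fun t => dphi t * snd (g (phi t)))).
      { intros t _. simpl. ring. }
      now apply (is_RInt_primitive_comp P2 (fun x => snd (g x))).
  - apply HQ. split; assumption.
Qed.

Lemma cline_int_RInt_gen (g : R -> C) (l : C) :
  cline_int g l ->
  @RInt_gen C_R_CompleteNormedModule g (Rbar_locally m_infty) (Rbar_locally p_infty) = l.
Proof.
  intros H. apply (is_RInt_gen_unique (V := C_R_CompleteNormedModule)).
  apply (is_RInt_gen_ext (V := C_R_NormedModule) (fun t => Cmult (RtoC 1) (g t))).
  { apply filter_forall. intros ab x _. apply Cmult_1_l. }
  apply (cline_int_subst g l (fun x => x) (fun _ => 1) _ _ H).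
  - intros Q HQ; exact HQ.
  - intros Q HQ; exact HQ.
  - apply filter_forall. intros ab t _. split; [apply (is_derive_id t)|apply continuous_const].
Qed.

(** * Gamma and beta integrals *)

(** This is e^{zu}, the complex power t^z at t = e^u; [cpow_pos t z] is [expw z (ln t)]. *)
Definition expw (z : C) (u : R) : C := Cmult (RtoC (exp (fst z * u))) (expi (snd z * u)).

Lemma expwE (z : C) (u : R) :
  expw z u = (exp (fst z * u) * cos (snd z * u), exp (fst z * u) * sin (snd z * u)).
Proof. unfold expw, expi, Cmult, RtoC. simpl. f_equal; ring. Qed.

Lemma Cmod_expi (t : R) : Cmod (expi t) = 1.
Proof.
  unfold Cmod, expi. simpl fst. simpl snd. rewrite <- sqrt_1. f_equal.
  rewrite <- (sin2_cos2 t). unfold Rsqr. ring.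
Qed.

Lemma Cmod_expw (z : C) (u : R) : Cmod (expw z u) = exp (fst z * u).
Proof.
  unfold expw. rewrite Cmod_mult, Cmod_expi, Cmod_R, Rmult_1_r.
  apply Rabs_pos_eq. left. apply exp_pos.
Qed.

Lemma expw_add_l (z w : C) (u : R) : expw (Cplus z w) u = Cmult (expw z u) (expw w u).
Proof.
  rewrite !expwE. simpl. rewrite !Rmult_plus_distr_r, exp_plus, cos_plus, sin_plus.
  unfold Cmult. simpl. f_equal; ring.
Qed.

Lemma expw_add_r (z : C) (u v : R) : expw z (u + v) = Cmult (expw z u) (expw z v).
Proof.
  rewrite !expwE. rewrite !Rmult_plus_distr_l, exp_plus, cos_plus, sin_plus.
  unfold Cmult. simpl. f_equal; ring.
Qed.

Lemma expw_R (s u : R) : expw (RtoC s) u = RtoC (exp (s * u)).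
Proof.
  rewrite expwE. simpl. rewrite Rmult_0_l, cos_0, sin_0. unfold RtoC. f_equal; ring.
Qed.

(** Euler's integrand at t = e^u: the Jacobian dt = e^u du turns t^{z-1} into t^z. *)
Definition gammaK (z : C) (u : R) : C := Cmult (expw z u) (RtoC (exp (- exp u))).

Lemma gammaKE (z : C) (u : R) :
  gammaK z u = (exp (fst z * u) * cos (snd z * u) * exp (- exp u),
                exp (fst z * u) * sin (snd z * u) * exp (- exp u)).
Proof. unfold gammaK. rewrite expwE. unfold Cmult, RtoC. simpl. f_equal; ring. Qed.

Lemma exp_gt_half_sqr (x : R) : 0 <= x -> x ^ 2 / 2 <= exp x.
Proof.
  intros Hx.
  assert (H : exp 0 - 0 ^ 2 / 2 <= exp x - x ^ 2 / 2).
  { apply (derive_nonneg_le (fun t => exp t - t ^ 2 / 2) (fun t => exp t - t)); [exact Hx| |].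
    - intros t _. auto_derive; [trivial|field].
    - intros t [Ht _]. destruct Ht as [Ht|<-]; [|rewrite exp_0; lra].
      pose proof (exp_ineq1 t ltac:(lra)). lra. }
  rewrite exp_0 in H. lra.
Qed.

Lemma Cmod_gammaK (z : C) (u : R) : Cmod (gammaK z u) = exp (fst z * u - exp u).
Proof.
  unfold gammaK. rewrite Cmod_mult, Cmod_expw, Cmod_R, Rabs_pos_eq by (left; apply exp_pos).
  now rewrite <- exp_plus.
Qed.

(** Put x = Re z. For u >= 0, expanding (u - 2x)^2 >= 0 gives 2xu - 2x^2 <= u^2/2 <= e^u, whence the
    constant exp(2x^2). For u < 0 the factor e^{xu} is already the required decay. *)
Lemma Cmod_gammaK_le (z : C) (u : R) :
  0 < fst z -> Cmod (gammaK z u) <= exp (2 * fst z ^ 2) * exp (- (fst z * Rabs u)).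
Proof.
  intros Hz. rewrite Cmod_gammaK, <- exp_plus. apply exp_le.
  destruct (Rle_lt_dec 0 u) as [Hu|Hu].
  - rewrite Rabs_pos_eq by assumption. pose proof (exp_gt_half_sqr u Hu).
    pose proof (pow2_ge_0 (u - 2 * fst z)). lra.
  - rewrite Rabs_left by assumption. pose proof (exp_pos u).
    pose proof (pow2_ge_0 (fst z)). lra.
Qed.

Lemma gammaK_continuous_fst (z : C) (x : R) : continuous (fun u => fst (gammaK z u)) x.
Proof.
  apply (continuous_ext (fun u => exp (fst z * u) * cos (snd z * u) * exp (- exp u))).
  { intros u. now rewrite gammaKE. }
  apply (ex_derive_continuous (fun u => exp (fst z * u) * cos (snd z * u) * exp (- exp u))).
  auto_derive; trivial.
Qed.

Lemma gammaK_continuous_snd (z : C) (x : R) : continuous (fun u => snd (gammaK z u)) x.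
Proof.
  apply (continuous_ext (fun u => exp (fst z * u) * sin (snd z * u) * exp (- exp u))).
  { intros u. now rewrite gammaKE. }
  apply (ex_derive_continuous (fun u => exp (fst z * u) * sin (snd z * u) * exp (- exp u))).
  auto_derive; trivial.
Qed.

(* The substitution [t = exp u] in Euler's integral. *)
Lemma cline_int_gammaK (z : C) : 0 < fst z -> cline_int (gammaK z) (CGamma z).
Proof.
  intros Hz.
  destruct (cline_int_exists (gammaK z) (exp (2 * fst z ^ 2)) (fst z)) as [l Hl]; auto.
  { left; apply exp_pos. }
  { apply gammaK_continuous_fst. }
  { apply gammaK_continuous_snd. }
  { intros t. now apply Cmod_gammaK_le. }
  replace (CGamma z) with l; [exact Hl|]. symmetry.
  (* Eventually both endpoints are positive, so [ln] is a legitimate substitution on the whole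
     interval between them. *)
  assert (Pos : filter_prod (at_right 0) (Rbar_locally p_infty)
                  (fun ab : R * R => 0 < fst ab /\ 0 < snd ab)).
  { apply (Filter_prod _ _ _ (fun a => 0 < a) (fun b => 0 < b)).
    - exists (mkposreal 1 Rlt_0_1). now intros y _.
    - exists 0. auto.
    - auto. }
  unfold CGamma. apply (is_RInt_gen_unique (V := C_R_CompleteNormedModule)).
  apply (is_RInt_gen_ext (V := C_R_NormedModule) (fun t => Cmult (RtoC (/ t)) (gammaK z (ln t)))).
  { revert Pos. apply filter_imp. intros [a b] [Ha Hb] x Hx. simpl in *.
    assert (0 < x) by (assert (0 < Rmin a b) by (now apply Rmin_glb_lt); lra).
    unfold gammaK. rewrite exp_ln by assumption.
    change (cpow_pos x (Cminus z (RtoC 1))) with (expw (Cplus z (Copp (RtoC 1))) (ln x)).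
    rewrite <- RtoC_opp, expw_add_l, expw_R.
    replace (exp (Ropp 1 * ln x)) with (/ x).
    - ring.
    - replace (Ropp 1 * ln x) with (- ln x) by ring. now rewrite exp_Ropp, exp_ln. }
  apply (cline_int_subst (gammaK z) l ln Rinv _ _ Hl).
  - exact is_lim_ln_0.
  - exact is_lim_ln_p.
  - revert Pos. apply filter_imp. intros [a b] [Ha Hb] x Hx. simpl in *.
    assert (0 < x) by (assert (0 < Rmin a b) by (now apply Rmin_glb_lt); lra).
    split; [now apply is_derive_ln|].
    apply (ex_derive_continuous Rinv). auto_derive. lra.
Qed.

Lemma exp_decay_lim_p (P : R -> R) (M e : R) :
  0 < e -> (forall t, Rabs (P t) <= M * exp (- (e * Rabs t))) -> is_lim P p_infty 0.
Proof.
  intros He Hb. apply (is_lim_le_le_loc (fun t => - M * exp (- (e * t))) (fun t => M * exp (- (e * t)))).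
  - exists 0. intros t Ht. specialize (Hb t). rewrite (Rabs_pos_eq t) in Hb by lra.
    apply Rabs_le_between in Hb. lra.
  - now apply exp_decay_lim.
  - now apply exp_decay_lim.
Qed.

Lemma exp_decay_lim_m (P : R -> R) (M e : R) :
  0 < e -> (forall t, Rabs (P t) <= M * exp (- (e * Rabs t))) -> is_lim P m_infty 0.
Proof.
  intros He Hb.
  apply (is_lim_ext (fun x => P (- (- x)))).
  { intros x. now rewrite Ropp_involutive. }
  refine (filterlim_comp _ _ _ Ropp (fun t => P (- t)) _ (Rbar_locally p_infty) _ _ _).
  - apply (is_lim_spec Ropp m_infty p_infty). intros A. exists (- A). intros x Hx. lra.
  - apply (exp_decay_lim_p (fun t => P (- t)) M e He). intros t. rewrite <- (Rabs_Ropp t). apply Hb.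
Qed.

(** Integration by parts without boundary terms. *)
Lemma line_int_derive_decay (P g : R -> R) (M e : R) :
  0 < e -> (forall x, continuous g x) -> (forall x, is_derive P x (g x)) ->
  (forall t, Rabs (P t) <= M * exp (- (e * Rabs t))) -> line_int g 0.
Proof.
  intros He Hc Hd Hb. split; [exact Hc|]. exists P, 0, 0.
  refine (conj Hd (conj _ (conj _ _))).
  - now apply (exp_decay_lim_m P M e).
  - now apply (exp_decay_lim_p P M e).
  - ring.
Qed.

(** The derivative of [gammaK z] in u is [z * gammaK z - gammaK (z + 1)], since differentiating
    exp(-e^u) brings down -e^u. As [gammaK z] decays at both ends, this derivative integrates to
    0. *)
Lemma CGamma_succ (z : C) :
  0 < fst z -> CGamma (Cplus z (RtoC 1)) = Cmult z (CGamma z).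
Proof.
  intros Hz.
  assert (Hz' : 0 < fst (Cplus z (RtoC 1))) by (simpl; lra).
  assert (H := cline_int_plus _ _ _ _
            (cline_int_scal z _ _ (cline_int_gammaK z Hz))
            (cline_int_scal (Copp (RtoC 1)) _ _ (cline_int_gammaK _ Hz'))).
  assert (H0 : cline_int (fun x => Cplus (Cmult z (gammaK z x))
                 (Cmult (Copp (RtoC 1)) (gammaK (Cplus z (RtoC 1)) x))) (RtoC 0)).
  { split.
    - apply (line_int_derive_decay (fun u => fst (gammaK z u)) _ (exp (2 * fst z ^ 2)) (fst z) Hz).
      + apply H.
      + intros x.
        apply (is_derive_ext (fun u => exp (fst z * u) * cos (snd z * u) * exp (- exp u))).
        { intros u. now rewrite gammaKE. }
        auto_derive; [trivial|]. rewrite !gammaKE. simpl.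
        replace ((fst z + 1) * x) with (fst z * x + x) by ring.
        rewrite exp_plus, Rplus_0_r. ring.
      + intros t. eapply Rle_trans; [apply Rabs_fst_le_Cmod|now apply Cmod_gammaK_le].
    - apply (line_int_derive_decay (fun u => snd (gammaK z u)) _ (exp (2 * fst z ^ 2)) (fst z) Hz).
      + apply H.
      + intros x.
        apply (is_derive_ext (fun u => exp (fst z * u) * sin (snd z * u) * exp (- exp u))).
        { intros u. now rewrite gammaKE. }
        auto_derive; [trivial|]. rewrite !gammaKE. simpl.
        replace ((fst z + 1) * x) with (fst z * x + x) by ring.
        rewrite exp_plus, Rplus_0_r. ring.
      + intros t. eapply Rle_trans; [apply Rabs_snd_le_Cmod|now apply Cmod_gammaK_le]. }
  assert (E := cline_int_unique _ _ _ H H0).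
  rewrite <- (Cplus_0_l (CGamma (Cplus z (RtoC 1)))), <- E.
  ring.
Qed.

Lemma CGamma_poch (z : C) (k : nat) :
  0 < fst z -> CGamma (Cplus z (RtoC (INR k))) = Cmult (pochC z k) (CGamma z).
Proof.
  intros Hz. induction k as [|k IH].
  - simpl. rewrite Cplus_0_r. ring.
  - rewrite S_INR, RtoC_plus, Cplus_assoc, CGamma_succ, IH.
    + simpl. ring.
    + simpl. pose proof (pos_INR k). lra.
Qed.

(** A primitive is nondecreasing and gains a positive amount on [0, 1], which bounds the difference
    of its limits from below. *)
Lemma line_int_pos (g : R -> R) (l : R) : (forall x, 0 < g x) -> line_int g l -> 0 < l.
Proof.
  intros Hg [Hc [P [lm [lp [Hd [H1 [H2 ->]]]]]]].
  assert (Mono : forall x y, x <= y -> P x <= P y).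
  { intros x y Hxy. apply (derive_nonneg_le P g); auto. intros t _. left. apply Hg. }
  assert (S : 0 < P 1 - P 0).
  { rewrite <- (RInt_primitive P g 0 1) by auto. apply RInt_gt_0; auto. lra. }
  assert (A : P 1 <= lp).
  { apply (is_lim_le_loc (fun _ => P 1) P p_infty (P 1) lp).
    - exists 1. intros y Hy. apply Mono. lra.
    - apply is_lim_const.
    - exact H2. }
  assert (B : lm <= P 0).
  { apply (is_lim_le_loc P (fun _ => P 0) m_infty lm (P 0)).
    - exists 0. intros y Hy. apply Mono. lra.
    - exact H1.
    - apply is_lim_const. }
  lra.
Qed.

Lemma CGamma_R_neq_0 (s : R) : 0 < s -> CGamma (RtoC s) <> RtoC 0.
Proof.
  intros Hs E. destruct (cline_int_gammaK (RtoC s) Hs) as [H _].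
  rewrite E in H. apply line_int_pos in H; [simpl in H; lra|].
  intros x. unfold gammaK. rewrite expw_R, <- RtoC_mult. simpl.
  apply Rmult_lt_0_compat; apply exp_pos.
Qed.

Lemma continuity_2d_fst_arg (h : R -> R) (x y : R) :
  (forall t, continuous h t) -> continuity_2d_pt (fun u _ => h u) x y.
Proof.
  intros Hc. apply (continuity_1d_2d_pt_comp h (fun u _ => u)); [|apply continuity_2d_pt_id1].
  apply continuity_pt_filterlim, Hc.
Qed.

Lemma continuity_2d_sum_arg (h : R -> R) (x y : R) :
  (forall t, continuous h t) -> continuity_2d_pt (fun u w => h (u + w)) x y.
Proof.
  intros Hc. apply (continuity_1d_2d_pt_comp h (fun u w => u + w)).
  - apply continuity_pt_filterlim, Hc.
  - apply continuity_2d_pt_plus; [apply continuity_2d_pt_id1|apply continuity_2d_pt_id2].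
Qed.

Definition betaK (q : C) (s w : R) : C := Cmult (expw q w) (RtoC (exp (- s * ln (1 + exp w)))).

Lemma ln_1_exp_ge (w : R) : 0 <= ln (1 + exp w) /\ w <= ln (1 + exp w).
Proof.
  pose proof (exp_pos w). split.
  - rewrite <- ln_1. apply ln_le; lra.
  - rewrite <- (ln_exp w) at 1. apply ln_le; lra.
Qed.

(** Since ln(1 + e^w) is at least 0 and at least w, the modulus is at most e^{w Re q} on the left
    and e^{-(s - Re q) w} on the right; the decay rate is the smaller of the two. *)
Lemma cline_int_betaK_exists (q : C) (s : R) :
  0 < fst q < s -> exists l, cline_int (betaK q s) l.
Proof.
  intros Hq.
  assert (E : forall w, betaK q s w =
    (exp (fst q * w) * cos (snd q * w) * exp (- s * ln (1 + exp w)),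
     exp (fst q * w) * sin (snd q * w) * exp (- s * ln (1 + exp w)))).
  { intros w. unfold betaK. rewrite expwE. unfold Cmult, RtoC. simpl. f_equal; ring. }
  apply (cline_int_exists _ 1 (Rmin (fst q) (s - fst q))).
  - apply Rmin_glb_lt; lra.
  - lra.
  - intros x. eapply continuous_ext; [intros u; rewrite E; reflexivity|].
    apply (ex_derive_continuous
             (fun w => exp (fst q * w) * cos (snd q * w) * exp (- s * ln (1 + exp w)))).
    auto_derive. pose proof (exp_pos x). lra.
  - intros x. eapply continuous_ext; [intros u; rewrite E; reflexivity|].
    apply (ex_derive_continuous
             (fun w => exp (fst q * w) * sin (snd q * w) * exp (- s * ln (1 + exp w)))).
    auto_derive. pose proof (exp_pos x). lra.
  - intros w. unfold betaK. rewrite Cmod_mult, Cmod_expw, Cmod_R, Rabs_pos_eq by (left; apply exp_pos).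
    rewrite Rmult_1_l, <- exp_plus. apply exp_le.
    pose proof (ln_1_exp_ge w) as [B1 B2].
    pose proof (Rmin_l (fst q) (s - fst q)). pose proof (Rmin_r (fst q) (s - fst q)).
    destruct (Rle_lt_dec 0 w).
    + rewrite Rabs_pos_eq by assumption.
      assert (Rmin (fst q) (s - fst q) * w <= (s - fst q) * w) by (now apply Rmult_le_compat_r).
      assert (s * w <= s * ln (1 + exp w)) by (apply Rmult_le_compat_l; lra). lra.
    + rewrite Rabs_left by assumption.
      assert (Rmin (fst q) (s - fst q) * - w <= fst q * - w) by (apply Rmult_le_compat_r; lra).
      assert (0 <= s * ln (1 + exp w)) by (apply Rmult_le_pos; lra). lra.
Qed.

(* Both values are the integral of
   [exp ((s - q) u - exp u) * exp (q (u + w) - exp (u + w))] over the plane. *)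
Lemma cline_int_betaK (q : C) (s : R) :
  0 < fst q < s ->
  cline_int (betaK q s)
    (Cdiv (Cmult (CGamma (Cminus (RtoC s) q)) (CGamma q)) (CGamma (RtoC s))).
Proof.
  intros Hq.
  assert (Hp : 0 < fst (Cminus (RtoC s) q)) by (simpl; lra).
  assert (Hs : 0 < fst (RtoC s)) by (simpl; lra).
  set (p := Cminus (RtoC s) q) in *.
  destruct (cline_int_betaK_exists q s Hq) as [l Hl].
  enough (E : Cmult (CGamma p) (CGamma q) = Cmult l (CGamma (RtoC s))).
  { replace (Cdiv (Cmult (CGamma p) (CGamma q)) (CGamma (RtoC s))) with l; [exact Hl|].
    rewrite E. field. apply CGamma_R_neq_0. lra. }
  set (a := fst p) in *. set (b := fst q) in *.
  apply (cline_int_fubini (fun u w => Cmult (gammaK p u) (gammaK q (u + w)))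
           (fun u => Cmult (gammaK p u) (CGamma q))
           (fun w => Cmult (betaK q s w) (CGamma (RtoC s)))
           _ _ (exp (2 * a ^ 2) * exp (2 * b ^ 2)) (Rmin a b / 2)).
  - apply Rdiv_lt_0_compat; [apply Rmin_glb_lt|]; lra.
  - left. apply Rmult_lt_0_compat; apply exp_pos.
  - intros x y. apply (continuity_2d_pt_minus (fun u w => fst (gammaK p u) * fst (gammaK q (u + w)))
                         (fun u w => snd (gammaK p u) * snd (gammaK q (u + w))));
      apply continuity_2d_pt_mult.
    + apply (continuity_2d_fst_arg (fun u => fst (gammaK p u))), gammaK_continuous_fst.
    + apply (continuity_2d_sum_arg (fun u => fst (gammaK q u))), gammaK_continuous_fst.
    + apply (continuity_2d_fst_arg (fun u => snd (gammaK p u))), gammaK_continuous_snd.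
    + apply (continuity_2d_sum_arg (fun u => snd (gammaK q u))), gammaK_continuous_snd.
  - intros x y. apply (continuity_2d_pt_plus (fun u w => fst (gammaK p u) * snd (gammaK q (u + w)))
                         (fun u w => snd (gammaK p u) * fst (gammaK q (u + w))));
      apply continuity_2d_pt_mult.
    + apply (continuity_2d_fst_arg (fun u => fst (gammaK p u))), gammaK_continuous_fst.
    + apply (continuity_2d_sum_arg (fun u => snd (gammaK q u))), gammaK_continuous_snd.
    + apply (continuity_2d_fst_arg (fun u => snd (gammaK p u))), gammaK_continuous_snd.
    + apply (continuity_2d_sum_arg (fun u => fst (gammaK q u))), gammaK_continuous_fst.
  - intros u w. rewrite Cmod_mult.
    eapply Rle_trans.
    { apply Rmult_le_compat; try apply Cmod_ge_0; apply Cmod_gammaK_le; [exact Hp|apply Hq]. }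
    fold a b.
    (* With m = min(a, b), the exponent a|u| + b|u+w| is at least m(|u| + |u+w|). This sum of moduli
       is at least |u| and, by the triangle inequality, at least |w|, hence at least their mean; so
       the rate is m/2. *)
    assert (exp (- (a * Rabs u)) * exp (- (b * Rabs (u + w)))
            <= exp (- (Rmin a b / 2 * Rabs u)) * exp (- (Rmin a b / 2 * Rabs w))).
    { rewrite <- !exp_plus. apply exp_le.
      assert (Tw : Rabs w <= Rabs (u + w) + Rabs u).
      { replace w with ((u + w) + - u) at 1 by ring. rewrite <- (Rabs_Ropp u). apply Rabs_triang. }
      assert (M0 : 0 <= Rmin a b) by (left; apply Rmin_glb_lt; lra).
      assert (Rmin a b * Rabs u <= a * Rabs u)
        by (apply Rmult_le_compat_r; [apply Rabs_pos|apply Rmin_l]).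
      assert (Rmin a b * Rabs (u + w) <= b * Rabs (u + w))
        by (apply Rmult_le_compat_r; [apply Rabs_pos|apply Rmin_r]).
      assert (Rmin a b * Rabs w <= Rmin a b * (Rabs (u + w) + Rabs u))
        by (now apply Rmult_le_compat_l).
      assert (0 <= Rmin a b * Rabs (u + w)) by (apply Rmult_le_pos; [lra|apply Rabs_pos]).
      lra. }
    assert (0 < exp (2 * a ^ 2) * exp (2 * b ^ 2)) by (apply Rmult_lt_0_compat; apply exp_pos).
    replace (exp (2 * a ^ 2) * exp (- (a * Rabs u)) * (exp (2 * b ^ 2) * exp (- (b * Rabs (u + w)))))
      with (exp (2 * a ^ 2) * exp (2 * b ^ 2) * (exp (- (a * Rabs u)) * exp (- (b * Rabs (u + w)))))
      by ring.
    rewrite (Rmult_assoc _ (exp (- (Rmin a b / 2 * Rabs u)))). apply Rmult_le_compat_l; lra.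
  (* For fixed [u] the integral in [w] is a translate of Euler's integral, handled as an affine
     change of slope 1. *)
  - intros u. apply cline_int_scal.
    replace (CGamma q) with (Cmult (RtoC (/ 1)) (CGamma q)) by (rewrite Rinv_1; ring).
    apply (cline_int_ext (fun w => gammaK q (1 * w + u))).
    { intros w. f_equal. ring. }
    apply cline_int_affine; [lra|]. now apply cline_int_gammaK.
  (* For fixed [w], e^u + e^{u+w} = e^{u+c}: translating [u] by [c] leaves Euler's integrand at p +
     q = s, and the factor e^{qw} e^{-sc} that comes out is [betaK q s w]. *)
  - intros w. set (c := ln (1 + exp w)).
    assert (Ec : exp c = 1 + exp w) by (apply exp_ln; pose proof (exp_pos w); lra).
    apply (cline_int_ext (fun u => Cmult (betaK q s w) (gammaK (RtoC s) (1 * u + c)))).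
    { intros u. rewrite Rmult_1_l. unfold betaK, gammaK. fold c.
      replace (exp (u + c)) with (exp u + exp (u + w)) by (rewrite !exp_plus, Ec; ring).
      rewrite expw_R. replace (RtoC s) with (Cplus p q) by (unfold p; ring).
      rewrite Ropp_plus_distr, exp_plus, RtoC_mult.
      replace (RtoC (exp (- s * c))) with (Cinv (expw (RtoC s) c)).
      - replace (RtoC (exp (s * (u + c)))) with (Cmult (expw (Cplus p q) u) (expw (RtoC s) c)).
        + rewrite expw_add_l, expw_add_r. field.
          rewrite expw_R. intros E0. apply RtoC_inj in E0. pose proof (exp_pos (s * c)). lra.
        + replace (Cplus p q) with (RtoC s) by (unfold p; ring).
          now rewrite <- expw_add_r, expw_R.
      - assert (exp (s * c) <> 0) by (pose proof (exp_pos (s * c)); lra).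
        rewrite expw_R, <- RtoC_inv by assumption. f_equal.
        now rewrite <- exp_Ropp, Ropp_mult_distr_l. }
    apply cline_int_scal.
    replace (CGamma (RtoC s)) with (Cmult (RtoC (/ 1)) (CGamma (RtoC s))) by (rewrite Rinv_1; ring).
    apply cline_int_affine; [lra|]. now apply cline_int_gammaK.
  - apply cline_int_scal_r. now apply cline_int_gammaK.
  - now apply cline_int_scal_r.
Qed.

(** * The one-dimensional transform *)

Lemma tanh_exp (y : R) : tanh y = 1 - 2 / (1 + exp (2 * y)).
Proof.
  unfold tanh, sinh, cosh. replace (2 * y) with (y + y) by ring.
  rewrite exp_plus, exp_Ropp. pose proof (exp_pos y).
  assert (0 < exp y * exp y) by (now apply Rmult_lt_0_compat).
  field. repeat split; lra.
Qed.

Lemma one_sub_tanh_half (y : R) : (1 - tanh y) / 2 = exp (- ln (1 + exp (2 * y))).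
Proof.
  pose proof (exp_pos (2 * y)).
  rewrite tanh_exp, exp_Ropp, exp_ln by lra. field. lra.
Qed.

(** Written as a single exponential so that real powers of it only scale an exponent. *)
Lemma one_sub_tanh_sqr (y : R) :
  1 - tanh y ^ 2 = 4 * exp (2 * y - 2 * ln (1 + exp (2 * y))).
Proof.
  pose proof (exp_pos (2 * y)).
  replace (2 * y - 2 * ln (1 + exp (2 * y)))
    with (2 * y + (- ln (1 + exp (2 * y)) + - ln (1 + exp (2 * y)))) by ring.
  rewrite tanh_exp, !exp_plus, exp_Ropp, exp_ln by lra. field. lra.
Qed.

Lemma one_sub_tanh_sqr_pos (y : R) : 0 < 1 - tanh y ^ 2.
Proof.
  rewrite one_sub_tanh_sqr. pose proof (exp_pos (2 * y - 2 * ln (1 + exp (2 * y)))). lra.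
Qed.

Lemma exp_pow (x : R) (k : nat) : exp x ^ k = exp (INR k * x).
Proof.
  rewrite <- Rpower_pow by apply exp_pos. unfold Rpower. now rewrite ln_exp.
Qed.

(** At w = 2y the integrand is 4^al times [betaK q s w] with q = al - i xi/2 and s = 2 al + k; since
    dy = dw/2, the constant is 4^al / 2 = 2^{2 al - 1}. With p = al + i xi/2, s - q = p + k, so the
    functional equation extracts (p)_k from Gamma(s - q) and (2 al)_k from Gamma(s). *)
Lemma cline_int_tanh_monomial (al xi : R) (k : nat) :
  0 < al ->
  cline_int
    (fun y => Cmult (expi (- (xi * y)))
       (RtoC (Rpower (1 - tanh y ^ 2) al * ((1 - tanh y) / 2) ^ k)))
    (Cmult (RtoC (Rpower 2 (2 * al - 1)))
       (Cmult (CBeta (al, xi / 2) (al, - xi / 2))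
              (Cdiv (pochC (al, xi / 2) k) (pochC (RtoC (2 * al)) k)))).
Proof.
  intros Hal.
  set (p := (al, xi / 2) : C). set (q := (al, - xi / 2) : C).
  set (s := 2 * al + INR k).
  assert (Hk := pos_INR k).
  assert (Hq : 0 < fst q < s) by (unfold q, s; simpl; lra).
  assert (Epq : Cplus p q = RtoC (2 * al)).
  { unfold p, q, Cplus, RtoC. simpl. f_equal; field. }
  assert (Ep : Cminus (RtoC s) q = Cplus p (RtoC (INR k))).
  { unfold s. rewrite RtoC_plus, <- Epq. ring. }
  assert (H := cline_int_scal (RtoC (Rpower 4 al)) _ _
                 (cline_int_affine 2 0 _ _ Rlt_0_2 (cline_int_betaK q s Hq))).
  assert (G2 : CGamma (RtoC (2 * al)) <> RtoC 0) by (apply CGamma_R_neq_0; lra).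
  assert (Gs : CGamma (RtoC s) = Cmult (pochC (RtoC (2 * al)) k) (CGamma (RtoC (2 * al)))).
  { unfold s. rewrite RtoC_plus. apply CGamma_poch. simpl. lra. }
  (* By [Gs], a zero of (2 al)_k would be a zero of Gamma at the positive real [s]. *)
  assert (Pk : pochC (RtoC (2 * al)) k <> RtoC 0).
  { intros E. rewrite E, Cmult_0_l in Gs. revert Gs. apply CGamma_R_neq_0. lra. }
  replace (Cmult _ (Cmult _ _))
    with (Cmult (RtoC (Rpower 4 al)) (Cmult (RtoC (/ 2))
            (Cdiv (Cmult (CGamma (Cminus (RtoC s) q)) (CGamma q)) (CGamma (RtoC s))))).
  2:{ rewrite Ep, Gs. unfold CBeta. rewrite Epq, CGamma_poch by exact Hal.
      replace (Rpower 2 (2 * al - 1)) with (Rpower 4 al * / 2).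
      - rewrite (RtoC_mult (Rpower 4 al)). field. now split.
      - unfold Rminus. rewrite Rpower_plus, Rpower_Ropp, Rpower_1 by lra.
        rewrite <- Rpower_mult. replace (Rpower 2 2) with 4; [reflexivity|].
        change 2 with (INR 2) at 2. rewrite Rpower_pow by lra. ring. }
  eapply cline_int_ext; [|exact H]. intros y.
  cbv beta. rewrite Rplus_0_r, one_sub_tanh_half, one_sub_tanh_sqr, exp_pow.
  unfold betaK, expw. set (c := ln (1 + exp (2 * y))).
  rewrite <- Rpower_mult_distr by (try apply exp_pos; lra).
  replace (snd q * (2 * y)) with (- (xi * y)) by (unfold q; simpl; field).
  assert (Hr : forall z, Rpower (exp z) al = exp (al * z)).
  { intros z. unfold Rpower. now rewrite ln_exp. }
  rewrite Hr.
  replace (Rpower 4 al * exp (al * (2 * y - 2 * c)) * exp (INR k * - c))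
    with (Rpower 4 al * (exp (fst q * (2 * y)) * exp (- s * c))).
  - rewrite !RtoC_mult. ring.
  - rewrite !Rmult_assoc, <- !exp_plus. unfold q, s. simpl. do 2 f_equal. ring.
Qed.

Lemma RtoC_sum_n (f : nat -> R) (n : nat) :
  RtoC (sum_n f n) = @sum_n C_AbelianMonoid (fun k => RtoC (f k)) n.
Proof.
  induction n as [|n IH].
  - now rewrite !sum_O.
  - rewrite !sum_Sn, <- IH. apply RtoC_plus.
Qed.

Lemma Cmult_sum_n (c : C) (f : nat -> C) (n : nat) :
  Cmult c (@sum_n C_AbelianMonoid f n) = @sum_n C_AbelianMonoid (fun k => Cmult c (f k)) n.
Proof.
  induction n as [|n IH].
  - now rewrite !sum_O.
  - rewrite !sum_Sn, <- IH. apply Cmult_plus_distr_l.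
Qed.

Lemma pochC_R (x : R) (k : nat) : pochC (RtoC x) k = RtoC (pochR x k).
Proof.
  induction k as [|k IH]; simpl; [reflexivity|].
  now rewrite IH, <- RtoC_plus, <- RtoC_mult.
Qed.

Lemma Cpow_1 (k : nat) : Cpow (RtoC 1) k = RtoC 1.
Proof. induction k as [|k IH]; simpl; [reflexivity|]. rewrite IH. ring. Qed.

Lemma pochR_pos (x : R) (k : nat) : 0 < x -> 0 < pochR x k.
Proof.
  intros Hx. induction k as [|k IH]; simpl; [lra|].
  apply Rmult_lt_0_compat; [exact IH|]. pose proof (pos_INR k). lra.
Qed.

Lemma Cinv_0 : Cinv (RtoC 0) = RtoC 0.
Proof. unfold Cinv, RtoC. simpl. f_equal; unfold Rdiv; ring. Qed.

(** The one-variable factor of both recursions: the first takes it at alpha_1 and lambda_1, the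
    second at [al = a] and [lam = mu]. *)
Definition gegenbauer_transform (n : nat) (lam al xi : R) : C :=
  Cmult (Cmult
    (RtoC (Rpower 2 (2 * al - 1) * pochR (2 * lam) n / INR (fact n)))
    (CBeta (al, xi / 2) (al, - xi / 2)))
    (hyp3F2 n (RtoC (INR n + 2 * lam)) (al, xi / 2)
            (RtoC (2 * al)) (RtoC (lam + / 2)) (RtoC 1)).

(** Integrating the k-th power of (1 - tanh y)/2 contributes (al + i xi/2)_k / (2 al)_k, one more
    upper and one more lower parameter: the 2F1 becomes a 3F2 at 1. *)
Lemma cline_int_gegenbauer (n : nat) (lam al xi : R) :
  0 < al ->
  cline_int
    (fun y => Cmult (expi (- (xi * y)))
       (RtoC (Rpower (1 - tanh y ^ 2) al * gegenbauer n lam (tanh y))))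
    (gegenbauer_transform n lam al xi).
Proof.
  intros Hal.
  (* The coefficient of ((1 - x)/2)^k in the Gegenbauer polynomial. *)
  set (d := fun k => pochR (2 * lam) n / INR (fact n)
              * (pochR (- INR n) k * pochR (INR n + 2 * lam) k / pochR (lam + / 2) k
                 / INR (fact k))).
  assert (H := cline_int_sum_n _ _ n
    (fun k _ => cline_int_scal (RtoC (d k)) _ _ (cline_int_tanh_monomial al xi k Hal))).
  cbv beta in H.
  replace (gegenbauer_transform n lam al xi) with
    (@sum_n C_AbelianMonoid (fun k => Cmult (RtoC (d k))
       (Cmult (RtoC (Rpower 2 (2 * al - 1)))
       (Cmult (CBeta (al, xi / 2) (al, - xi / 2))
              (Cdiv (pochC (al, xi / 2) k) (pochC (RtoC (2 * al)) k))))) n).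
  - eapply cline_int_ext; [|exact H]. intros y. cbv beta.
    unfold gegenbauer, hyp2F1.
    rewrite <- (sum_n_mult_l (K := R_Ring)), <- (sum_n_mult_l (K := R_Ring)), RtoC_sum_n.
    rewrite Cmult_sum_n. apply sum_n_ext. intros k. unfold d, mult. simpl.
    rewrite Cmult_comm, <- Cmult_assoc. f_equal. rewrite Cmult_comm, <- !RtoC_mult.
    f_equal. unfold Rdiv. ring.
  - unfold gegenbauer_transform, hyp3F2. rewrite Cmult_sum_n. apply sum_n_ext. intros k.
    lazymatch goal with |- @eq _ ?u ?v => change (@eq C u v) end.
    rewrite Cpow_1, !pochC_R. unfold d.
    assert (Hf : RtoC (INR (fact k)) <> RtoC 0).
    { intros E. apply RtoC_inj in E. revert E. apply INR_fact_neq_0. }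
    assert (H2 : RtoC (pochR (2 * al) k) <> RtoC 0).
    { intros E. apply RtoC_inj in E. pose proof (pochR_pos (2 * al) k ltac:(lra)). lra. }
    destruct (Req_dec (pochR (lam + / 2) k) 0) as [E|E].
    (* A vanishing [(lam + 1/2)_k] kills the k-th term on both sides, since x / 0 = 0. *)
    + rewrite E, Cmult_0_r, Cmult_0_l. unfold Cdiv. rewrite Cinv_0.
      unfold Rdiv. rewrite Rinv_0, !Rmult_0_r, Rmult_0_l, Rmult_0_r. ring.
    + assert (E' : RtoC (pochR (lam + / 2) k) <> RtoC 0).
      { intros E0. now apply RtoC_inj in E0. }
      assert (Hn : RtoC (INR (fact n)) <> RtoC 0).
      { intros E0. apply RtoC_inj in E0. revert E0. apply INR_fact_neq_0. }
      unfold Rdiv. rewrite !RtoC_mult, !RtoC_inv by (try apply INR_fact_neq_0; exact E).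
      field. repeat split; assumption.
Qed.

(** * Factorization of the ball functions *)

Lemma prodR_ext (f g : nat -> R) (m : nat) :
  (forall j, (j < m)%nat -> f j = g j) -> prodR f m = prodR g m.
Proof.
  intros H. induction m as [|m IH]; simpl; [reflexivity|].
  rewrite H by lia. rewrite IH; [reflexivity|]. intros j Hj. apply H. lia.
Qed.

Lemma prodR_S_l (f : nat -> R) (m : nat) : prodR f (S m) = f O * prodR (fun j => f (S j)) m.
Proof.
  induction m as [|m IH]; [simpl; ring|].
  change (prodR f (S m) * f (S m) = f O * (prodR (fun j => f (S j)) m * f (S m))).
  rewrite IH. ring.
Qed.

Lemma prodR_mult (f g : nat -> R) (m : nat) :
  prodR (fun j => f j * g j) m = prodR f m * prodR g m.
Proof. induction m as [|m IH]; simpl; [ring|]. rewrite IH. ring. Qed.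

Lemma prodR_pos (f : nat -> R) (m : nat) : (forall j, 0 < f j) -> 0 < prodR f m.
Proof.
  intros H. induction m as [|m IH]; simpl; [lra|]. now apply Rmult_lt_0_compat.
Qed.

Lemma prodR_pow_nth (x : R) (n : list nat) :
  prodR (fun j => x ^ nth j n O) (length n) = x ^ list_sum n.
Proof.
  induction n as [|k n IH]; [reflexivity|].
  cbn [length]. rewrite prodR_S_l. cbn [nth]. rewrite IH.
  change (list_sum (k :: n)) with (k + list_sum n)%nat. now rewrite pow_add.
Qed.

Definition sech2_prod (y : list R) (j : nat) : R :=
  prodR (fun i => 1 - tanh (nth i y 0) ^ 2) j.

Lemma sech2_prod_pos (y : list R) (j : nat) : 0 < sech2_prod y j.
Proof. apply prodR_pos. intros i. apply one_sub_tanh_sqr_pos. Qed.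

Definition fball_weight (y : list R) (n : list nat) (a : R) : R :=
  prodR (fun j => Rpower (1 - tanh (nth j y 0) ^ 2)
                         (a + (INR (length n) - INR (S j)) / 4)) (length n).

(** The ball polynomial at the upsilon_j: the root contained in upsilon_j cancels the one dividing
    it, so the Gegenbauer argument is tanh y_j. *)
Definition fball_ball (y : list R) (n : list nat) (mu : R) : R :=
  prodR (fun j => sqrt (sech2_prod y j) ^ nth j n O *
     gegenbauer (nth j n O)
       (mu + INR (list_sum (skipn (S j) n)) + (INR (length n) - INR (S j)) / 2)
       (tanh (nth j y 0))) (length n).

(* The upsilon_j satisfy [1 - upsilon_1^2 - ... - upsilon_j^2 = prod_(i <= j) (1 - tanh^2 y_i)]. *)
Lemma fball_split (y : list R) (n : list nat) (a mu : R) :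
  fball y n a mu = fball_weight y n a * fball_ball y n mu.
Proof.
  unfold fball. cbv zeta. unfold fball_weight. f_equal.
  unfold ball_poly. cbv zeta.
  set (ups := map _ _).
  assert (Hu : forall j, (j < length n)%nat ->
                 nth j ups 0 = tanh (nth j y 0) * sqrt (sech2_prod y j)).
  { intros j Hj. unfold ups.
    (* The default 0 is exchanged for the image of index 0, the form in which [nth] commutes with
       [map]. *)
    rewrite (nth_indep _ 0 ((fun j0 => tanh (nth j0 y 0) * sqrt (sech2_prod y j0)) O))
      by (now rewrite length_map, length_seq).
    etransitivity; [apply (map_nth (fun j0 => tanh (nth j0 y 0) * sqrt (sech2_prod y j0)))|].
    now rewrite seq_nth. }
  assert (Hn : forall j, (j <= length n)%nat ->
                 1 - sumR (fun i => nth i ups 0 ^ 2) j = sech2_prod y j).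
  { intros j. induction j as [|j IH]; intros Hj.
    - unfold sech2_prod. simpl. ring.
    - specialize (IH ltac:(lia)). cbn [sumR]. rewrite (Hu j) by lia.
      rewrite Rpow_mult_distr, pow2_sqrt by (left; apply sech2_prod_pos).
      change (sech2_prod y (S j)) with (sech2_prod y j * (1 - tanh (nth j y 0) ^ 2)).
      rewrite <- IH. ring. }
  apply prodR_ext. intros j Hj.
  rewrite Hn by lia. rewrite Hu by lia. do 2 f_equal.
  field. apply Rgt_not_eq, sqrt_lt_R0, sech2_prod_pos.
Qed.

(** The exponent at a position depends only on how many variables follow it, so the tail factors are
    those of the shorter list. *)
Lemma fball_weight_cons (y1 : R) (ys : list R) (n1 : nat) (n : list nat) (a : R) :
  fball_weight (y1 :: ys) (n1 :: n) a =
  Rpower (1 - tanh y1 ^ 2) (a + INR (length n) / 4) * fball_weight ys n a.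
Proof.
  unfold fball_weight. cbn [length]. rewrite prodR_S_l. cbn [nth]. f_equal.
  - do 2 f_equal. rewrite S_INR. simpl. field.
  - apply prodR_ext. intros j _. do 2 f_equal. rewrite !S_INR. field.
Qed.

(** Every later factor j carries the root of 1 - tanh^2 y_1 to the power n_j; collecting them gives
    the total degree of the tail. *)
Lemma fball_ball_cons (y1 : R) (ys : list R) (n1 : nat) (n : list nat) (mu : R) :
  fball_ball (y1 :: ys) (n1 :: n) mu =
  gegenbauer n1 (mu + INR (list_sum n) + INR (length n) / 2) (tanh y1) *
  sqrt (1 - tanh y1 ^ 2) ^ list_sum n * fball_ball ys n mu.
Proof.
  unfold fball_ball. cbn [length]. rewrite prodR_S_l. cbn [nth].
  symmetry. rewrite Rmult_assoc, <- prodR_pow_nth, <- prodR_mult. symmetry. f_equal.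
  - change (sech2_prod (y1 :: ys) 0) with 1. rewrite sqrt_1, pow1, Rmult_1_l.
    f_equal. rewrite S_INR. simpl. field.
  - apply prodR_ext. intros j _.
    assert (E : sech2_prod (y1 :: ys) (S j) = (1 - tanh y1 ^ 2) * sech2_prod ys j).
    { unfold sech2_prod. now rewrite prodR_S_l. }
    rewrite E, sqrt_mult_alt by (left; apply one_sub_tanh_sqr_pos).
    rewrite Rpow_mult_distr, Rmult_assoc. do 2 f_equal. cbn [skipn].
    f_equal. rewrite !S_INR. field.
Qed.

Lemma fball_cons (y1 : R) (ys : list R) (n1 : nat) (n : list nat) (a mu : R) :
  fball (y1 :: ys) (n1 :: n) a mu =
  Rpower (1 - tanh y1 ^ 2) (a + INR (list_sum n) / 2 + INR (length n) / 4) *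
  gegenbauer n1 (mu + INR (list_sum n) + INR (length n) / 2) (tanh y1) * fball ys n a mu.
Proof.
  pose proof (one_sub_tanh_sqr_pos y1) as Hp.
  rewrite !fball_split, fball_weight_cons, fball_ball_cons.
  set (X := 1 - tanh y1 ^ 2) in *.
  (* This power of the root is the source of the term |n^2|/2 in alpha_1. *)
  replace (sqrt X ^ list_sum n) with (Rpower X (/ 2 * INR (list_sum n))).
  2:{ rewrite <- Rpower_mult, Rpower_sqrt by exact Hp. apply Rpower_pow, sqrt_lt_R0, Hp. }
  replace (a + INR (list_sum n) / 2 + INR (length n) / 4)
    with ((a + INR (length n) / 4) + / 2 * INR (list_sum n)) by field.
  rewrite (Rpower_plus (a + INR (length n) / 4)). ring.
Qed.

(** The closed form of the transform; the value 1 on empty lists is the convention for f_0. *)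
Fixpoint fball_transform (n : list nat) (a mu : R) (xi : list R) : C :=
  match n, xi with
  | n1 :: n', x1 :: xs =>
      Cmult (gegenbauer_transform n1 (mu + INR (list_sum n') + INR (length n') / 2)
               (a + INR (list_sum n') / 2 + INR (length n') / 4) x1)
            (fball_transform n' a mu xs)
  | _, _ => RtoC 1
  end.

(** The constant [c] makes the induction go through: to the inner integrals, the factor depending on
    [y1] is a constant that joins [c]. *)
Lemma fourier_fball_scal (c : C) (n : list nat) (a mu : R) (xi : list R) :
  0 < a -> length n = length xi ->
  fourier (fun y => Cmult c (RtoC (fball y n a mu))) xi = Cmult c (fball_transform n a mu xi).
Proof.
  intros Ha. revert c xi. induction n as [|n1 n IH]; intros c [|x1 xs] Hl; try discriminate.
  - simpl. unfold fball, ball_poly. simpl. now rewrite Rmult_1_l.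
  - injection Hl as Hl. cbn [fourier fball_transform].
    apply cline_int_RInt_gen.
    set (lam := mu + INR (list_sum n) + INR (length n) / 2).
    set (al := a + INR (list_sum n) / 2 + INR (length n) / 4).
    set (T := fball_transform n a mu xs).
    replace (Cmult c (Cmult (gegenbauer_transform n1 lam al x1) T))
      with (Cmult (Cmult c T) (gegenbauer_transform n1 lam al x1)) by ring.
    assert (Hal : 0 < al).
    { unfold al. pose proof (pos_INR (list_sum n)). pose proof (pos_INR (length n)). lra. }
    eapply cline_int_ext; [|apply cline_int_scal, (cline_int_gegenbauer n1 lam al x1 Hal)].
    intros y1. cbv beta.
    set (h := Rpower (1 - tanh y1 ^ 2) al * gegenbauer n1 lam (tanh y1)).
    replace (fun ys => Cmult c (RtoC (fball (y1 :: ys) (n1 :: n) a mu)))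
      with (fun ys => Cmult (Cmult c (RtoC h)) (RtoC (fball ys n a mu))).
    + rewrite IH by exact Hl. fold T. ring.
    + apply functional_extensionality. intros ys.
      rewrite fball_cons. fold al lam h. rewrite RtoC_mult. ring.
Qed.

Lemma fourier_fball (n : list nat) (a mu : R) (xi : list R) :
  0 < a -> length n = length xi ->
  fourier (fun y => RtoC (fball y n a mu)) xi = fball_transform n a mu xi.
Proof.
  intros Ha Hl. rewrite <- (Cmult_1_l (fball_transform n a mu xi)).
  rewrite <- (fourier_fball_scal (RtoC 1) n a mu xi Ha Hl). f_equal.
  apply functional_extensionality. intros y. now rewrite Cmult_1_l.
Qed.

Lemma list_sum_removelast (n : list nat) :
  list_sum n = (list_sum (removelast n) + last n O)%nat.
Proof.
  induction n as [|k [|k' n] IH]; [reflexivity|simpl; lia|].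
  change (k + list_sum (k' :: n) = k + list_sum (removelast (k' :: n)) + last (k' :: n) O)%nat.
  rewrite IH. lia.
Qed.

Lemma length_removelast_S (A : Type) (x : A) (l : list A) :
  length (removelast (x :: l)) = length l.
Proof.
  revert x. induction l as [|y l IH]; intros x; [reflexivity|].
  change (S (length (removelast (y :: l))) = S (length l)). now rewrite IH.
Qed.

(* Moving [n_s] into the parameters as [a + n_s/2 + 1/4] and [mu + n_s + 1/2] compensates,
   in every other factor, for the last index being dropped. *)
Lemma fball_transform_last (n : list nat) (a mu : R) (xi : list R) :
  n <> nil -> length n = length xi ->
  fball_transform n a mu xi =
  Cmult (gegenbauer_transform (last n O) mu a (last xi 0))
    (fball_transform (removelast n) (a + INR (last n O) / 2 + / 4)
       (mu + INR (last n O) + / 2) (removelast xi)).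
Proof.
  revert xi. induction n as [|n1 n IH]; intros [|x1 xs] Hn Hl; try easy.
  injection Hl as Hl. destruct n as [|n2 n].
  - destruct xs; [|discriminate]. simpl. unfold Rdiv. now rewrite !Rmult_0_l, !Rplus_0_r.
  - destruct xs as [|x2 xs]; [discriminate|].
    change (removelast (n1 :: n2 :: n)) with (n1 :: removelast (n2 :: n)).
    change (removelast (x1 :: x2 :: xs)) with (x1 :: removelast (x2 :: xs)).
    change (last (n1 :: n2 :: n) O) with (last (n2 :: n) O).
    change (last (x1 :: x2 :: xs) 0) with (last (x2 :: xs) 0).
    specialize (IH (x2 :: xs) ltac:(easy) Hl).
    set (m := n2 :: n) in *. set (zs := x2 :: xs) in *.
    cbn [fball_transform]. rewrite IH.
    replace (INR (length m)) with (INR (length (removelast m)) + 1).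
    2:{ unfold m. rewrite length_removelast_S. cbn [length]. now rewrite S_INR. }
    rewrite (list_sum_removelast m), plus_INR.
    set (N := INR (list_sum (removelast m))). set (k := INR (last m O)).
    set (L := INR (length (removelast m))).
    (* Losing the last index costs [k] in the degree sum and 1 in the number of later variables; the
       shifts k + 1/2 of [mu] and k/2 + 1/4 of [a] restore exactly this. *)
    replace (mu + (N + k) + (L + 1) / 2) with (mu + k + / 2 + N + L / 2) by field.
    replace (a + (N + k) / 2 + (L + 1) / 4) with (a + k / 2 + / 4 + N / 2 + L / 4) by field.
    ring.
Qed.

Theorem theorem3p1 (r : nat) (a mu : R) (n : list nat) (xi : list R) :
  (1 <= r)%nat -> 0 < a -> length n = r -> length xi = r ->
  (* first formula: peel off the first variable *)
  (let n1 := nth 0 n O in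
   let xi1 := nth 0 xi 0 in
   let N := INR (list_sum (tl n)) in               (* |n^2| *)
   let L := N + mu + (INR r - 1) / 2 in
   let A := a + N / 2 + (INR r - 1) / 4 in
   fourier (fun y => RtoC (fball y n a mu)) xi =
   Cmult (Cmult (Cmult
     (RtoC (Rpower 2 (N + 2 * a + (INR r - 3) / 2) * pochR (2 * L) n1 / INR (fact n1)))
     (CBeta (A, xi1 / 2) (A, - xi1 / 2)))
     (hyp3F2 n1 (RtoC (INR n1 + 2 * L)) (A, xi1 / 2)
             (RtoC (N + 2 * a + (INR r - 1) / 2)) (RtoC (N + mu + INR r / 2)) (RtoC 1)))
     (fourier (fun y => RtoC (fball y (tl n) a mu)) (tl xi)))
  /\
  (* second formula: peel off the last variable *)
  (let nr := last n O in
   let xir := last xi 0 in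
   fourier (fun y => RtoC (fball y n a mu)) xi =
   Cmult (Cmult (Cmult
     (RtoC (Rpower 2 (2 * a - 1) * pochR (2 * mu) nr / INR (fact nr)))
     (CBeta (a, xir / 2) (a, - xir / 2)))
     (hyp3F2 nr (RtoC (INR nr + 2 * mu)) (a, xir / 2) (RtoC (2 * a)) (RtoC (mu + / 2)) (RtoC 1)))
     (fourier (fun y => RtoC (fball y (removelast n) (a + INR nr / 2 + / 4) (mu + INR nr + / 2)))
              (removelast xi))).
Proof.
  intros Hr Ha Hn Hx.
  destruct n as [|n1 n]; [simpl in Hn; lia|]. destruct xi as [|x1 xs]; [simpl in Hx; lia|].
  assert (Hl : length n = length xs) by (simpl in Hn, Hx; lia).
  (* The left sides of both formulas become the closed form at once. *)
  rewrite fourier_fball by (simpl; auto). split; cbv zeta.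
  - cbn [nth tl]. rewrite fourier_fball by assumption.
    cbn [fball_transform]. f_equal. unfold gegenbauer_transform.
    subst r. cbn [length]. rewrite S_INR.
    set (N := INR (list_sum n)). set (M := INR (length n)).
    (* Here M + 1 is [r]. In terms of alpha_1 and lambda_1 the exponent of 2 is 2 alpha_1 - 1, and
       the lower parameters are 2 alpha_1 and lambda_1 + 1/2. *)
    replace (mu + N + M / 2) with (N + mu + (M + 1 - 1) / 2) by field.
    replace (a + N / 2 + M / 4) with (a + N / 2 + (M + 1 - 1) / 4) by field.
    replace (N + 2 * a + (M + 1 - 3) / 2) with (2 * (a + N / 2 + (M + 1 - 1) / 4) - 1) by field.
    replace (N + 2 * a + (M + 1 - 1) / 2) with (2 * (a + N / 2 + (M + 1 - 1) / 4)) by field.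
    replace (N + mu + (M + 1) / 2) with (N + mu + (M + 1 - 1) / 2 + / 2) by field.
    reflexivity.
  - rewrite fourier_fball.
    + apply fball_transform_last; [discriminate|simpl; auto].
    (* The shifted parameter a + n_r/2 + 1/4 is still positive, so the reduced transform converges
       too. *)
    + pose proof (pos_INR (last (n1 :: n) O)). lra.
    + now rewrite !length_removelast_S.
Qed.
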